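(* For all integers $1\le p\le q\le r$, the tree $T_4(p,q,r)$ is determined by its Laplacian spectrum: every graph $H$ whose Laplacian spectrum equals that of $T_4(p,q,r)$ is isomorphic to $T_4(p,q,r)$.
   Context: All graphs are finite, simple and undirected. For a graph $G$, $A(G)$ is its adjacency matrix, $D(G)$ the diagonal matrix of vertex degrees, and $L(G)=D(G)-A(G)$ its Laplacian matrix; the Laplacian spectrum is the multiset of eigenvalues of $L(G)$. For integers $p,q,r\ge 1$, $T_4(p,q,r)$ is the tree obtained as follows: take a central vertex $c$ and three further vertices $a,b,d$; join $c$ to $a$, $b$, $d$ by internally vertex-disjoint paths with $p$, $q$, $r$ edges respectively; then attach two pendant vertices to each of $a$, $b$, $d$. It has $p+q+r+7$ vertices, exactly $4$ vertices of degree $3$ ($c,a,b,d$) and $6$ leaves. One always assumes $1\le p\le q\le r$. *)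

(* Defs.v *)
From HB Require Import structures.
From mathcomp Require Import all_boot all_order all_algebra all_field.

Set Implicit Arguments.
Unset Strict Implicit.
Unset Printing Implicit Defensive.

Import Order.TTheory GRing.Theory Num.Theory.

Local Open Scope ring_scope.

Record sgraph := SGraph {
  vertex :> finType;
  edge : rel vertex;
  edge_sym : symmetric edge;
  edge_irr : irreflexive edge
}.

Definition isomorphic (G H : sgraph) : Prop :=
  exists2 f : G -> H, bijective f & forall u v, edge (f u) (f v) = edge u v.

Definition degree (G : sgraph) (u : G) : nat := #|[set v | edge u v]|.

(* Rows and columns are indexed by the vertices through [enum_val]. *)
Definition adjacency_mx (R : nzRingType) (G : sgraph) : 'M[R]_#|G| :=
  \matrix_(i, j) (edge (enum_val i) (enum_val j))%:R.

Definition degree_mx (R : nzRingType) (G : sgraph) : 'M[R]_#|G| :=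
  diag_mx (\row_i (degree (enum_val i))%:R).

Definition laplacian (R : nzRingType) (G : sgraph) : 'M[R]_#|G| :=
  degree_mx R G - adjacency_mx R G.

(* The eigenvalues listed with multiplicity, in an unspecified order: it is to
   be compared with [perm_eq] only. Laplacians are integer symmetric matrices, so
   their real eigenvalues all lie in [algC]. *)
Definition spectrum (n : nat) (A : 'M[algC]_n) : seq algC :=
  sval (closed_field_poly_normal (char_poly A)).

Definition same_laplacian_spectrum (G H : sgraph) : Prop :=
  perm_eq (spectrum (laplacian algC G)) (spectrum (laplacian algC H)).

Definition determined_by_laplacian_spectrum (G : sgraph) : Prop :=
  forall H : sgraph, same_laplacian_spectrum H G -> isomorphic H G.

Section T4.

Variables p q r : nat.

Definition arm_length (i : 'I_3) : nat := nth 0%N [:: p; q; r] i.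

(* [None] is the center c. For an arm i, [Some (inl (Tagged _ j))] is the vertex
   at distance j + 1 from c on the path of arm i, so that the last one
   (j + 1 = arm_length i) is a, b or d; [Some (inr (i, _))] are the two pendant
   vertices attached to it. *)
Definition T4_vertex : finType :=
  option ({i : 'I_3 & 'I_(arm_length i)} + 'I_3 * bool)%type.

(* Edges oriented away from c. *)
Definition T4_arc (u v : T4_vertex) : bool :=
  match u, v with
  | None, Some (inl y) => tagged y == 0%N :> nat
  | Some (inl x), Some (inl y) =>
      (tag x == tag y) && (tagged y == (tagged x).+1 :> nat)
  | Some (inl x), Some (inr (i, _)) =>
      (tag x == i) && ((tagged x).+1 == arm_length i)
  | _, _ => false
  end.

Definition T4_edge : rel T4_vertex := [rel u v | T4_arc u v || T4_arc v u].

Lemma T4_edge_sym : symmetric T4_edge.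
Proof. by move=> u v; rewrite /T4_edge /= orbC. Qed.

Lemma T4_edge_irr : irreflexive T4_edge.
Proof.
by case=> [[x|[i b]]|] //; rewrite /T4_edge /= ?eqxx /= ?eqn_leq ?ltnn ?andbF.
Qed.

Definition T4 : sgraph := SGraph T4_edge_sym T4_edge_irr.

End T4.

(* Main.v *)
Require Import Defs.
From mathcomp Require Import all_boot all_order all_algebra all_field.
From mathcomp Require Import all_fingroup.
From mathcomp Require Import ring zify.

Set Implicit Arguments.
Unset Strict Implicit.
Unset Printing Implicit Defensive.

Import Order.TTheory GRing.Theory Num.Theory.

Local Open Scope ring_scope.

(** Let H have the Laplacian spectrum of T = T_4(p,q,r). The multiplicity of the eigenvalue 0 and
    the trace make H connected with n - 1 edges, so H is a tree and can be rooted at any vertex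
    ([same_rooted]).

    Write L - 2 = S - A with S the diagonal matrix of the excesses deg - 2. A tree is bipartite, so
    words with an odd number of factors A contribute nothing to tr (S - A)^k. The moments with k <=
    3 determine the first three power sums of the excess; hence (d - 1)(d - 2)(d - 3) sums to 0 over
    H, all degrees are at most 3, and H has six leaves ([same_subcubic], [same_leaves]). The moments
    4 and 5 then force each leaf of H to hang on a vertex of degree 3 ([same_leaf_neighbors]).

    So the six leaves are spread over four branch vertices, at most two on each, and [leaf_cases]
    leaves two shapes. If one branch vertex has no leaf, H is some T_4(P,Q,R) ([star_isomorphic]).
    Otherwise two branch vertices carry one leaf each. Both shapes are settled by evaluating det(x -
    L) at chosen points, using elimination from the leaves to the root ([rooted_pivot]): along a
    path the pivots obey f' = x - 2 - 1/f, so they are quotients of consecutive terms of a linear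
    recurrence.

    For the first shape, put x = t + 1/t + 2. The determinant depends on the arms through the
    symmetric functions of t^(2p), t^(2q), t^(2r), and the values t = 1/2, -1/2 together determine
    4^p + 4^q + 4^r, hence the arms ([T4_det_inj]). For the second, put x = 3 + 2t with t^2 = 1 - t
    and 0 < t < 1. Then t is a fixed point of the recursion and also the pivot of a branch vertex
    with two leaves, so all pivots off the path between the two exceptional vertices are known;
    comparison with T contradicts an inequality of sizes ([golden_caterpillar]). *)

Definition vmx (R : nzRingType) (T : finType) (F : T -> T -> R) : 'M[R]_#|T| :=
  \matrix_(i, j) F (enum_val i) (enum_val j).

(** * Matrices indexed by vertices *)

Section Vmx.
Variables (R : comNzRingType) (T : finType).
Implicit Types F K : T -> T -> R.

Lemma sum_enum_val (V : nmodType) (f : T -> V) :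
  \sum_(i < #|T|) f (enum_val i) = \sum_v f v.
Proof.
by rewrite [RHS](reindex _ (onW_bij predT (@enum_val_bij T))).
Qed.

Lemma mul_vmx F K :
  vmx F *m vmx K = vmx (fun u v => \sum_w F u w * K w v).
Proof.
apply/matrixP=> i j; rewrite !mxE -sum_enum_val.
by apply: eq_bigr => k _; rewrite !mxE.
Qed.

Lemma trace_vmx F : \tr (vmx F) = \sum_v F v v.
Proof. by rewrite -sum_enum_val; apply: eq_bigr => i _; rewrite mxE. Qed.

Lemma laplacian_vmx (G : sgraph) : laplacian R G =
  vmx (fun u v => (u == v)%:R * (degree u)%:R - (edge u v)%:R).
Proof.
apply/matrixP=> i j; rewrite !mxE (inj_eq enum_val_inj).
by case: eqVneq => [->|_]; rewrite ?mulr1n ?mulr0n ?mul1r ?mul0r.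
Qed.

(** A permutation contributing a non-zero term never decreases [d] and strictly increases it at each
    moved point. Since permuting the indices preserves the sum of [d], only the identity
    contributes. *)
Lemma det_unitriangular F (d : T -> nat) :
    (forall v, F v v = 1) -> (forall u v, u != v -> F u v != 0 -> (d u < d v)%N) ->
  \det (vmx F) = 1.
Proof.
move=> F1 Fd; rewrite /determinant (bigD1 (1%g : {perm 'I_#|T|})) //= big1 => [|i _]; last first.
  by rewrite perm1 mxE F1.
rewrite odd_perm1 expr0 mulr1 big1 ?addr0 // => s s1.
have [/forallP sF|] := boolP [forall i, vmx F i (s i) != 0]; last first.
  rewrite negb_forall => /existsP[i]; rewrite negbK => /eqP si0.
  by rewrite (bigD1 i) //= si0 mul0r mulr0.
pose D (i : 'I_#|T|) := d (enum_val i).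
have lt_D i : s i != i -> (D i < D (s i))%N.
  move=> si; apply: Fd; first by rewrite (inj_eq enum_val_inj) eq_sym.
  by have := sF i; rewrite mxE.
have le_D i : (D i <= D (s i))%N.
  by have [->//|si] := eqVneq (s i) i; apply/ltnW/lt_D.
have [i si] : exists i, s i != i.
  apply/existsP; apply: contraNT s1; rewrite negb_exists => /forallP s1.
  by apply/eqP/permP=> i; rewrite perm1; apply/eqP; have := s1 i; rewrite negbK.
have: (\sum_i D i < \sum_i D (s i))%N.
  rewrite (bigD1 i) // [ltnRHS](bigD1 i) // -addSn leq_add ?lt_D //.
  by apply: leq_sum => j _.
by rewrite [ltnLHS](reindex_inj (@perm_inj _ s)) ltnn.
Qed.

End Vmx.

Lemma det_bij (R : comNzRingType) (m n : nat) (A : 'M[R]_m) (B : 'M[R]_n)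
    (s : 'I_m -> 'I_n) :
  bijective s -> (forall i j, A i j = B (s i) (s j)) -> \det A = \det B.
Proof.
move=> s_bij AB; have mn : m = n by have := bij_eq_card s_bij; rewrite !card_ord.
subst n; have s_inj := bij_inj s_bij; pose g := perm s_inj.
have ->: A = row_perm g (col_perm g B).
  by apply/matrixP=> i j; rewrite !mxE !permE AB.
rewrite row_permE col_permE !det_mulmx det_perm.
rewrite -?tr_perm_mx ?det_tr ?det_perm.
by rewrite mulrCA ?odd_permV -signr_addb addbb mulr1.
Qed.

(** A tree presented by its parent map: the growth of [d] away from [c] excludes cycles. The value
    [d c] is left free; [d c = 0] is assumed separately where depths are counted. *)
Definition rooted (G : sgraph) (c : G) (d : G -> nat) (par : G -> G) : Prop :=
  (forall v, v != c -> d v = (d (par v)).+1) /\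
  (forall u v, edge u v =
     ((v != c) && (u == par v)) || ((u != c) && (v == par u))).

(** * Rooted trees and elimination along them *)

Section Rooted.
Variables (G : sgraph) (c : G) (d : G -> nat) (par : G -> G).
Hypothesis GR : rooted c d par.

Lemma rooted_d v : v != c -> d v = (d (par v)).+1. Proof. exact: GR.1. Qed.

Lemma rooted_edge v : v != c -> edge v (par v).
Proof. by move=> vc; rewrite GR.2 vc eqxx orbT. Qed.

Lemma rooted_ind (P : G -> Prop) :
  P c -> (forall v, v != c -> P (par v) -> P v) -> forall v, P v.
Proof.
move=> Pc Pp v; have [k] := ubnP (d v); elim: k v => // k IH v dv.
have [->//|vc] := eqVneq v c; apply: (Pp _ vc); apply: IH.
by move: dv; rewrite (rooted_d vc) ltnS.
Qed.

Lemma rooted_neq u v : edge u v -> d u <> d v.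
Proof.
rewrite GR.2 => /orP[]/andP[uc /eqP E]; rewrite (rooted_d uc) -E.
  by move=> /eqP; rewrite -[X in X == _]addn0 -addn1 eqn_add2l.
by move=> /eqP; rewrite -[X in _ == X]addn0 -addn1 eqn_add2l.
Qed.

Lemma rooted_odd u v : edge u v -> odd (d u) = ~~ odd (d v).
Proof.
by rewrite GR.2 => /orP[]/andP[uc /eqP E]; rewrite (rooted_d uc) -E //= negbK.
Qed.

Lemma rooted_sum (V : nmodType) (f : G -> V) v :
  \sum_(u | edge v u) f u =
  (if v != c then f (par v) else 0) + \sum_(u | (u != c) && (v == par u)) f u.
Proof.
have [vc|vc] /= := ifPn.
  rewrite (bigD1 (par v)) /= ?rooted_edge //; congr (_ + _); apply: eq_bigl => u.
  rewrite GR.2 vc /=; have [->|] /= := eqVneq u (par v); last by rewrite orbF andbT.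
  rewrite orbT andbF; apply/esym/negbTE/negP => /andP[pc /eqP E].
  by have := rooted_d vc; rewrite (rooted_d pc) -E; lia.
by rewrite add0r; apply: eq_bigl => u; rewrite GR.2 (negbTE vc) orbF.
Qed.

Lemma rooted_degree v :
  degree v = ((v != c) + #|[set u | (u != c) && (v == par u)]|)%N.
Proof.
rewrite /degree -!sum1_card (eq_bigl (edge v)) => [|u]; last by rewrite inE.
rewrite (rooted_sum (fun=> 1%N)); case: ifP => _; congr (_ + _)%N;
  by apply: eq_bigl => u; rewrite inE.
Qed.

(* Gaussian elimination from the leaves to the root: [f v] is the pivot of [v]. *)
Lemma rooted_pivot (F : fieldType) (x : F) (f : G -> F) :
    (forall v, v != c -> f v != 0) ->
    (forall v, f v = x - (degree v)%:R - \sum_(u | (u != c) && (v == par u)) (f u)^-1) ->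
  \det (x%:M - laplacian F G) = \prod_v f v.
Proof.
move=> f0 fE.
(* The aim is the factorization x - L = U D U^T. Column [v] of [U] is supported on [v] and its
   parent, so [U] is unitriangular for the depth. *)
pose U u v : F := (u == v)%:R + ((v != c) && (u == par v))%:R / f v.
pose D u v : F := (u == v)%:R * f v.
have parn v : v != c -> (v == par v) = false.
  by move=> vc; apply/negbTE/eqP => E; have := rooted_d vc; rewrite -E; lia.
have Udet : \det (vmx U) = 1.
  apply: (det_unitriangular (d := d)) => [v|u v]; rewrite /U.
    rewrite eqxx; case: (boolP (v != c)) => vc; last by rewrite mul0r addr0.
    by rewrite parn // mul0r addr0.
  move=> /negbTE ->; rewrite add0r; case: (boolP (v != c)) => vc /=.
    have [-> _|_] := eqVneq u (par v); first by rewrite (rooted_d vc).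
    by rewrite mul0r eqxx.
  by rewrite mul0r eqxx.
have Ddet : \det (vmx D) = \prod_v f v.
  have ->: vmx D = diag_mx (\row_i f (enum_val i)).
    apply/matrixP=> i j; rewrite !mxE /D (inj_eq enum_val_inj).
    by case: eqVneq => [->|_]; rewrite ?mul1r ?mul0r ?mulr1n ?mulr0n.
  rewrite det_diag [RHS](reindex _ (onW_bij predT (@enum_val_bij G))) /=.
  by apply: eq_bigr => i _; rewrite mxE.
have ->: x%:M - laplacian F G = vmx U *m vmx D *m (vmx U)^T; last first.
  by rewrite !det_mulmx det_tr Udet Ddet mul1r mulr1.
have ->: (vmx U)^T = vmx (fun u v => U v u) by apply/matrixP=> i j; rewrite !mxE.
rewrite laplacian_vmx !mul_vmx; apply/matrixP=> i j.
rewrite !mxE -(inj_eq enum_val_inj); move: (enum_val i) (enum_val j) => u v {i j}.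
have UD w : \sum_y U u y * D y w = U u w * f w.
  rewrite (bigD1 w) //= big1 ?addr0 => [|y /negbTE yw]; first by rewrite /D eqxx mul1r.
  by rewrite /D yw mul0r mulr0.
under eq_bigr => w _ do rewrite UD.

pose C w := (w != c) && (u == par w).
pose C' w := (w != c) && (v == par w).
(* The terms are, in order: the diagonal pivot, [u] a child of [v], [v] a child of [u], and a common
   child [w]. The last forces [u = v] and yields the sum over children in the pivot equation. *)
transitivity (\sum_w ((u == w)%:R * ((u == v)%:R * f w + (C' w)%:R) +
   ((v == w)%:R * (C w)%:R + (C w && C' w)%:R / f w))); last first.
  apply: eq_bigr => w _; rewrite /U -/(C w) -/(C' w).
  have [E|wc] := eqVneq w c.
    rewrite /C /C' E eqxx /= !mul0r !addr0 mulr0 addr0.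
    by case: (eqVneq u c) => [->|] /=; rewrite ?mul0r // !mul1r mulrC eq_sym.
  have := f0 _ wc; move: (f w) => y y0.
  have CC : (C w && C' w)%:R = (C w)%:R * (C' w)%:R :> F by rewrite -natrM mulnb.
  rewrite CC; have uv : (u == w)%:R * (u == v)%:R = (u == w)%:R * (v == w)%:R :> F.
    by have [->|] := eqVneq u w; rewrite ?mul0r // [w == v]eq_sym.
  by rewrite mulrDr !mulrA uv; field.
rewrite big_split /= (bigD1 u) //= eqxx mul1r [X in _ + X + _]big1 ?addr0; last first.
  by move=> w /negbTE wu; rewrite eq_sym wu mul0r.
rewrite big_split /= (bigD1 v) //= eqxx mul1r [X in _ + (_ + X + _)]big1 ?addr0; last first.
  by move=> w /negbTE wu; rewrite eq_sym wu mul0r.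
have {UD}-> : (edge u v)%:R = (C' u)%:R + (C v)%:R :> F.
  rewrite GR.2 -/(C v) -/(C' u) orbC; case E1: (C' u); case E2: (C v); rewrite ?addr0 ?add0r //.
  move: E1 E2 => /andP[uc /eqP E1] /andP[vc /eqP E2].
  by have := rooted_d uc; have := rooted_d vc; rewrite -E1 -E2; lia.
have [E|uv] := eqVneq u v.
  subst v; rewrite mulr1n !mul1r (_ : \sum_w _ = \sum_(w | C w) (f w)^-1).
    by rewrite [in LHS]/C' fE -/C; ring.
  rewrite [RHS]big_mkcond; apply: eq_bigr => w _; rewrite andbb.
  by case: (C w); rewrite ?mul1r ?mul0r.
rewrite mulr0n !mul0r !sub0r big1 => [|w _].
  by rewrite opprK add0r addr0.
case: (boolP (_ && _)) => [/andP[/andP[_ /eqP E] /andP[_ /eqP E']]|_]; last by rewrite mul0r.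
by rewrite E E' eqxx in uv.
Qed.
End Rooted.

Lemma card_set_sum (T : finType) (A : {set T}) : #|A| = (\sum_x (x \in A))%N.
Proof. by rewrite -sum1_card big_mkcond; apply: eq_bigr => x _; case: (x \in A). Qed.

(** * Connected graphs with n - 1 edges are rooted trees *)

Definition connected (G : sgraph) : Prop := forall u v : G, connect (@edge G) u v.

Lemma connected_ind (G : sgraph) (c : G) (P : G -> Prop) :
  connected G -> P c -> (forall u v, edge u v -> P u -> P v) -> forall v, P v.
Proof.
move=> Gc Pc Pe v; have /connectP[s sp ->] := Gc c v.
by elim: s c Pc sp => //= x s IH c Pc /andP[/Pe cx]; apply: IH; apply: cx.
Qed.

Lemma rooted_connected (G : sgraph) (c : G) d par : rooted c d par -> connected G.
Proof.
move=> Gr; have sc : connect_sym (@edge G) by apply/sym_connect_sym/edge_sym.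
have cv : forall v, connect (@edge G) c v.
  apply: (rooted_ind Gr) => [|v vc]; first exact: connect0.
  move=> /connect_trans; apply; apply: connect1.
  by rewrite edge_sym; apply: (rooted_edge Gr).
by move=> u v; apply: connect_trans (cv v); rewrite sc.
Qed.

Section Distance.
Variables (G : sgraph) (c : G).
Hypothesis Gc : connected G.

Fixpoint walk (k : nat) (v : G) : bool :=
  if k is k'.+1 then [exists u, walk k' u && edge u v] else v == c.

Lemma ex_walk v : exists k, walk k v.
Proof.
move: v; apply: (connected_ind (c := c)) => //; first by exists 0%N; rewrite /= eqxx.
by move=> u v uv [k ku]; exists k.+1; apply/existsP; exists u; apply/andP.
Qed.

Definition dist v := ex_minn (ex_walk v).

Lemma distP v : walk (dist v) v /\ forall k, walk k v -> (dist v <= k)%N.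
Proof. by rewrite /dist; case: ex_minnP. Qed.

Lemma dist_root : dist c = 0%N.
Proof. by apply/eqP; rewrite -leqn0; apply: (distP c).2; rewrite /= eqxx. Qed.

Lemma dist_pred v : v != c -> exists u, edge u v && (dist v == (dist u).+1).
Proof.
have [dv dmin] := distP v; case E: (dist v) dv => [|k] /=; first by move=> ->.
move=> /existsP[u /andP[ku uv]] _; exists u; rewrite uv eqSS eqn_leq.
have [du umin] := distP u; rewrite umin // andbT -ltnS -E dmin //=.
by apply/existsP; exists u; apply/andP.
Qed.

Definition dist_par v := odflt c [pick u | edge u v && (dist v == (dist u).+1)].

Lemma dist_parP v : v != c -> edge (dist_par v) v && (dist v == (dist (dist_par v)).+1).
Proof.
move=> /dist_pred[u uP]; rewrite /dist_par.
by case: pickP => [x //|/(_ u)]; rewrite uP.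
Qed.

(* The [2 (n - 1)] darts joining a vertex to its parent exhaust all darts. *)
Lemma dist_rooted : (\sum_(v : G) degree v)%N = (2 * #|G|.-1)%N -> rooted c dist dist_par.
Proof.
move=> sumd; split=> [v /dist_parP/andP[_ /eqP]//|].
pose E := [set p : G * G | edge p.1 p.2].
pose E1 := [set (v, dist_par v) | v in [set~ c]].
pose E2 := [set (dist_par v, v) | v in [set~ c]].
have cardE : #|E| = (2 * #|G|.-1)%N.
  rewrite -sumd -sum1_card (eq_bigl (fun p : G * G => edge p.1 p.2)) => [|p]; last first.
    by rewrite inE.
  rewrite -(pair_big_dep xpredT (fun u v => edge u v) (fun _ _ => 1%N)) /=.
  by apply: eq_bigr => u _; rewrite sum1dep_card /degree; apply: eq_card => v; rewrite !inE.
have card1 : #|E1| = #|G|.-1.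
  by rewrite card_imset ?cardsC1 // => u v [].
have card2 : #|E2| = #|G|.-1.
  by rewrite card_imset ?cardsC1 // => u v [].
have E12 : E1 :&: E2 = set0.
  apply/setP=> -[u v]; rewrite !inE; apply/negbTE/negP => /andP[].
  move=> /imsetP[x]; rewrite !inE => /dist_parP/andP[_ /eqP dx] [ux vx].
  move=> /imsetP[y]; rewrite !inE => /dist_parP/andP[_ /eqP dy] [uy vy].
  by move: dx dy; rewrite -vx -uy -ux -vy; lia.
have sE : E1 :|: E2 \subset E.
  apply/subsetP=> p; rewrite inE => /orP[]/imsetP[x]; rewrite !inE => /dist_parP/andP[ex _] ->.
    by rewrite edge_sym.
  by [].
have EE : E1 :|: E2 = E.
  apply/eqP; rewrite eqEcard sE cardsU E12 cards0 subn0 card1 card2 cardE; lia.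
move=> u v; have : ((u, v) \in E) = edge u v by rewrite inE.
move=> <-; rewrite -EE inE orbC; congr (_ || _).
  apply/imsetP/andP => [[x]|[vc /eqP ->]]; last by exists v; rewrite // !inE.
  by rewrite !inE => xc [-> ->].
apply/imsetP/andP => [[x]|[uc /eqP ->]]; last by exists u; rewrite // !inE.
by rewrite !inE => xc [-> ->].
Qed.

End Distance.

Lemma connected_rooted (G : sgraph) (c : G) :
    connected G -> (\sum_(v : G) degree v)%N = (2 * #|G|.-1)%N ->
  exists d par, rooted c d par /\ d c = 0%N.
Proof.
move=> Gc sumd; exists (dist c Gc), (dist_par c Gc); split; first exact: dist_rooted.
exact: dist_root.
Qed.

Lemma rooted_sum_degree (G : sgraph) (c : G) d par :
  rooted c d par -> (\sum_(v : G) degree v)%N = (2 * #|G|.-1)%N.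
Proof.
move=> Gr; under eq_bigr => v _ do rewrite (rooted_degree Gr).
have cC : (\sum_(v : G) (v != c))%N = #|G|.-1.
  by rewrite -(cardsC1 c) card_set_sum; apply: eq_bigr => v _; rewrite !inE.
rewrite big_split /= cC mulSn mul1n; congr addn.
under eq_bigr => v _ do (rewrite card_set_sum; under eq_bigr => u _ do rewrite inE).
rewrite exchange_big /= -[RHS]cC; apply: eq_bigr => v _.
have [->|vc] /= := eqVneq v c; first by rewrite big1.
by rewrite (bigD1 (par v)) //= eqxx big1 // => u /negbTE ->.
Qed.

(** * Graph isomorphisms *)

Lemma isomorphic_sym (G H : sgraph) : isomorphic G H -> isomorphic H G.
Proof.
move=> [f [g fg gf] fe]; exists g; first by exists f.
by move=> u v; rewrite -fe !gf.
Qed.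

(* A covering of a connected graph with a one-point fibre is an isomorphism. *)
Lemma covering_isomorphic (X H : sgraph) (phi : X -> H) (x0 : X) :
    connected H ->
    (forall x y, edge x y -> edge (phi x) (phi y)) ->
    (forall x, degree (phi x) = degree x) ->
    (forall x y y', edge x y -> edge x y' -> phi y = phi y' -> y = y') ->
    (forall x, phi x = phi x0 -> x = x0) ->
  isomorphic X H.
Proof.
move=> Hc hom deg linj fib0.
(* Around [x] the map is an injection between neighbourhoods of equal size, hence onto. *)
have lsurj x v : edge (phi x) v -> exists2 y, edge x y & phi y = v.
  have sN : [set phi y | y in [set y | edge x y]] \subset [set v | edge (phi x) v].
    by apply/subsetP=> w /imsetP[y]; rewrite !inE => /hom xy ->.
  have /eqP EN : [set phi y | y in [set y | edge x y]] == [set v | edge (phi x) v].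
    rewrite eqEcard sN /= card_in_imset; first by have := deg x; rewrite /degree => ->.
    by move=> y y'; rewrite !inE => xy xy'; apply: linj xy xy'.
  move=> xv; have : v \in [set v | edge (phi x) v] by rewrite inE.
  by rewrite -EN => /imsetP[y]; rewrite inE => xy ->; exists y.
have surj v : exists x, phi x = v.
  move: v; apply: (connected_ind (c := phi x0) Hc); first by exists x0.
  by move=> u v uv [x E]; move: uv; rewrite -E => /lsurj[y _ <-]; exists y.
(* Having at most one preimage propagates along the edges of the connected graph [H]. *)
have inj v : forall x y, phi x = v -> phi y = v -> x = y.
  move: v; apply: (connected_ind (c := phi x0) Hc) => [x y /fib0 -> /fib0 ->//|u v uv IH x y xv yv].
  have [x' xx' x'u] : exists2 x', edge x x' & phi x' = u by apply: lsurj; rewrite xv edge_sym.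
  have [y' yy' y'u] : exists2 y', edge y y' & phi y' = u by apply: lsurj; rewrite yv edge_sym.
  have E := IH _ _ x'u y'u; rewrite -E in yy'.
  by apply: (linj x'); rewrite ?xv // edge_sym.
have phi_inj : injective phi by move=> x y E; apply: (inj (phi y)).
exists phi.
  have surj' v : exists x, phi x == v by have [x <-] := surj v; exists x.
  exists (fun v => xchoose (surj' v)) => [x|v]; last exact/eqP/(xchooseP (surj' v)).
  by apply: phi_inj; exact/eqP/(xchooseP (surj' _)).
move=> x y; apply/idP/idP => [/lsurj[z xz /phi_inj <-]//|]; exact: hom.
Qed.

Lemma isomorphic_det (F : comNzRingType) (G H : sgraph) (x : F) :
  isomorphic G H -> \det (x%:M - laplacian F G) = \det (x%:M - laplacian F H).
Proof.
move=> [f fb fe].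
have fdeg u : degree (f u) = degree u.
  rewrite /degree -(card_imset _ (bij_inj fb)); apply: eq_card => v; have [g fg gf] := fb.
  rewrite inE; apply/idP/imsetP => [uv|[w]]; last by rewrite inE -fe => uw ->.
  by exists (g v); rewrite ?inE ?gf // -fe gf.
pose s (i : 'I_#|G|) : 'I_#|H| := enum_rank (f (enum_val i)).
have s_bij : bijective s.
  by apply: bij_comp (@enum_rank_bij _) _; apply: bij_comp fb (@enum_val_bij _).
apply: (det_bij s_bij) => i j; rewrite !laplacian_vmx !mxE !enum_rankK fe fdeg.
by rewrite !(inj_eq (bij_inj s_bij)) (inj_eq (bij_inj fb)).
Qed.

(** * Spectrum, moments, and the multiplicity of the eigenvalue 0 *)

Lemma char_poly_spectrum n (A : 'M[algC]_n) :
  char_poly A = \prod_(z <- spectrum A) ('X - z%:P).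
Proof.
rewrite /spectrum; case: closed_field_poly_normal => s /= E; rewrite {1}E.
by have := char_poly_monic A; rewrite monicE => /eqP ->; rewrite scale1r.
Qed.

Lemma size_spectrum n (A : 'M[algC]_n) : size (spectrum A) = n.
Proof.
by apply: succn_inj; rewrite -(size_char_poly A) char_poly_spectrum size_prod_XsubC.
Qed.

Lemma det_spectrum n (A : 'M[algC]_n) (x : algC) :
  \det (x%:M - A) = \prod_(z <- spectrum A) (x - z).
Proof.
transitivity (char_poly A).[x].
  rewrite -[RHS]/(horner_eval x _) -det_map_mx; congr (\det _); apply/matrixP=> i j.
  by rewrite !mxE -[RHS]/(_.[x]) hornerD hornerMn hornerX hornerN hornerC.
by rewrite char_poly_spectrum horner_prod; apply: eq_bigr => z _; rewrite !hornerE.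
Qed.

Lemma char_poly_conj (F : fieldType) n (P A : 'M[F]_n) :
  P \in unitmx -> char_poly (invmx P *m A *m P) = char_poly A.
Proof.
move=> Pu; rewrite /char_poly /char_poly_mx; set B := map_mx polyC P.
have Bu : \det (map_mx polyC (invmx P)) * \det B = 1.
  by rewrite -det_mulmx -map_mxM mulVmx // map_mx1 det1.
rewrite -[RHS]mul1r -Bu mulrAC -!det_mulmx; congr determinant.
rewrite mulmxBr mulmxBl !map_mxM; congr (_ - _).
by rewrite -mulmxA -scalar_mxC mulmxA -map_mxM mulVmx // map_mx1 mul1mx.
Qed.

Lemma sum_delta (R : pzSemiRingType) (T : finType) (v : T) (g : T -> R) :
  \sum_u (u == v)%:R * g u = g v.
Proof.
rewrite (bigD1 v) //= eqxx mul1r big1 => [|u /negbTE ->]; first by rewrite addr0.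
by rewrite mul0r.
Qed.

Lemma count_enum (T : finType) (p : pred T) : count p (enum T) = #|p|.
Proof. by rewrite enumT -size_filter cardE. Qed.

Section Spectral.
Variable G : sgraph.
Let L := laplacian algC G.

(** A real symmetric matrix is normal, so the spectral theorem applies. *)
Lemma laplacian_diag : exists P : 'M[algC]_#|G|, exists D : 'rV[algC]_#|G|,
  [/\ P \in unitmx, L = invmx P *m diag_mx D *m P &
      perm_eq (spectrum L) [seq D 0 i | i <- enum 'I_#|G|]].
Proof.
have Ln : L \is normalmx.
  apply/normalmxP; suff ->: (L ^t Num.conj = L)%sesqui by [].
  apply/matrixP=> i j; rewrite /L laplacian_vmx !mxE rmorphB rmorphM. rewrite !rmorph_nat edge_sym.
  by congr (_ - _); rewrite eq_sym; case: eqVneq => [->|]; rewrite ?mul0r.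
have /orthomx_spectralP E := Ln.
exists (spectralmx L), (spectral_diag L); split=> //; first exact: spectral_unit.
apply: prod_XsubC_eq; rewrite -char_poly_spectrum {1}E char_poly_conj ?spectral_unit //.
rewrite char_poly_trig ?diag_mx_is_trig // big_map big_enum /=.
by apply: eq_bigr => i _; rewrite mxE eqxx.
Qed.

Lemma trace_spectrum (a : algC) k :
  \tr ((L - a%:M) ^+ k) = \sum_(z <- spectrum L) (z - a) ^+ k.
Proof.
have [P [D [Pu E pe]]] := laplacian_diag; rewrite (perm_big _ pe) /=.
have ->: (L - a%:M) ^+ k = invmx P *m diag_mx (\row_i (D 0 i - a) ^+ k) *m P.
  elim: k => [|k IH]; last rewrite exprS -[_ * _]/(_ *m _).
    rewrite expr0 -[1]/(1%:M) (_ : \row_i _ = const_mx 1) ?diag_const_mx ?mulmx1 ?mulVmx //.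
    by apply/rowP=> i; rewrite !mxE.
  rewrite IH; have ->: L - a%:M = invmx P *m diag_mx (\row_i (D 0 i - a)) *m P.
    have ->: \row_i (D 0 i - a) = D - const_mx a by apply/rowP=> i; rewrite !mxE.
    rewrite linearB /= diag_const_mx mulmxBr mulmxBl -E.
    by rewrite mul_mx_scalar -scalemxAl mulVmx // scalemx1.
  rewrite !mulmxA mulmxK //; congr (_ *m _).
  rewrite -[LHS]mulmxA; congr (_ *m _).
  apply: (etrans (mulmx_diag _ _)); congr diag_mx.
  by apply/rowP=> i; rewrite !mxE exprS.
rewrite mxtrace_mulC mulmxA mulmxV // mul1mx mxtrace_diag big_map big_enum /=.
by apply: eq_bigr => i _; rewrite mxE.
Qed.

(** Two zero diagonal entries would make two rows of the invertible matrix [P] constant vectors,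
    hence linearly dependent. *)
Lemma spectrum0_le1 :
    (forall psi : 'rV[algC]_#|G|, psi *m L = 0 -> exists a, psi = const_mx a) ->
  (count_mem 0%R (spectrum L) <= 1)%N.
Proof.
move=> Lker; have [P [D [Pu E /seq.permP ->]]] := laplacian_diag.
rewrite count_map count_enum.
apply/card_le1_eqP => i j; rewrite !inE => /eqP Di /eqP Dj.
have ker k : D 0 k = 0 -> exists a, (delta_mx 0 k : 'rV_#|G|) *m P = const_mx a.
  move=> Dk; apply: Lker; rewrite E !mulmxA mulmxK // -rowE row_diag_mx Dk scale0r mul0mx //.
have [[a Ea] [b Eb]] := (ker _ Di, ker _ Dj).
have Pinj : injective (fun x : 'rV_#|G| => x *m P) := can_inj (mulmxK Pu).
have /rowP ab : b *: delta_mx 0 i = a *: delta_mx 0 j :> 'rV[algC]_#|G|.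
  apply: Pinj; rewrite -!scalemxAl Ea Eb; apply/rowP=> k; rewrite !mxE; exact: mulrC.
apply/eqP; case: eqVneq => // ij; have := ab i; have := ab j.
rewrite !mxE !eqxx /= (negbTE ij) eq_sym (negbTE ij) !mulr0 !mulr1 => a0 b0.
have : delta_mx 0 i = 0 :> 'rV[algC]_#|G|.
  by apply: Pinj; rewrite Ea -a0 mul0mx; apply/rowP=> k; rewrite !mxE.
by move/rowP/(_ i); rewrite !mxE !eqxx => /eqP; rewrite oner_eq0.
Qed.

Lemma laplacian_kerP (f : G -> algC) :
  ((\row_i f (enum_val i)) *m L = 0) <->
  (forall v, (degree v)%:R * f v = \sum_(u | edge v u) f u).
Proof.
have rowE v : ((\row_i f (enum_val i)) *m L) 0 (enum_rank v) =
    (degree v)%:R * f v - \sum_(u | edge v u) f u.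
  rewrite mxE /L laplacian_vmx.
  under eq_bigr => i _ do rewrite !mxE enum_rankK.
  rewrite (sum_enum_val (fun u => f u * ((u == v)%:R * (degree u)%:R - (edge u v)%:R))).
  under eq_bigr => u _ do rewrite mulrBr.
  rewrite sumrB; congr (_ - _).
    under eq_bigr => u _ do rewrite mulrC -mulrA.
    by rewrite sum_delta.
  rewrite [RHS]big_mkcond; apply: eq_bigr => u _; rewrite edge_sym.
  by case: (edge v u); rewrite ?mulr1 ?mulr0.
split=> [E v|E]; first by apply/eqP; rewrite -subr_eq0 -rowE E mxE.
apply/rowP=> i; rewrite -(enum_valK i) rowE mxE; apply/eqP; rewrite subr_eq0.
exact/eqP/E.
Qed.

(** The indicator of the component of [c] and the all-ones vector both lie in the kernel, which is
    at most a line; being proportional, they show that the component is everything. *)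
Lemma spectrum0_connected : (count_mem 0%R (spectrum L) <= 1)%N -> connected G.
Proof.
have [P [D [Pu E /seq.permP ->]]] := laplacian_diag.
rewrite count_map count_enum.
move=> /card_le1_eqP D1 c.
pose f v : algC := (connect (@edge G) c v)%:R.
have ker (g : G -> algC) : (forall u v, edge v u -> g u = g v) ->
    (\row_i g (enum_val i)) *m L = 0.
  move=> ge; apply/laplacian_kerP => v; rewrite (eq_bigr (fun=> g v)); last by move=> u /ge.
  rewrite sumr_const mulr_natl /degree; congr (_ *+ _); apply: eq_card => u.
  by rewrite inE.
have supp (x : 'rV_#|G|) i : x *m L = 0 -> D 0 i != 0 -> (x *m invmx P) 0 i = 0.
  move=> xL Di; have : x *m invmx P *m diag_mx D = 0.
    by apply: (can_inj (mulmxK Pu)); rewrite mul0mx -xL E !mulmxA.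
  move=> /rowP/(_ i); rewrite mul_mx_diag !mxE => /eqP; rewrite mulf_eq0 (negbTE Di) orbF.
  by move/eqP.
have sc : connect_sym (@edge G) by apply/sym_connect_sym/edge_sym.
pose x : 'rV[algC]_#|G| := \row_i f (enum_val i); pose y : 'rV[algC]_#|G| := \row_i 1.
have xk : x *m L = 0.
  apply: ker => u v vu; congr (_%:R); congr nat_of_bool.
  by apply/esym/(same_connect_r sc); apply: connect1.
have yk : y *m L = 0 by apply: (ker (fun=> 1)).
have y0 : y *m invmx P != 0.
  apply/eqP => y0; have : y = 0 by rewrite -(mulmxKV Pu y) y0 mul0mx.
  by move/rowP/(_ (enum_rank c)); rewrite !mxE => /eqP; rewrite oner_eq0.
have /rV0Pn[i yi] := y0.
have Di : D 0 i = 0 by apply/eqP; apply: contraNT yi => /(supp _ _ yk) ->.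
pose a := (x *m invmx P) 0 i / (y *m invmx P) 0 i.
have /rowP xy : x = a *: y.
  rewrite -[LHS](mulmxKV Pu) -[y in RHS](mulmxKV Pu) scalemxAl; congr (_ *m _).
  have scE (z : 'rV[algC]_#|G|) j : (a *: z) 0 j = a * z 0 j by rewrite mxE.
  apply/rowP=> j; rewrite scE.
  have [->|ji] := eqVneq j i; first by rewrite /a divfK.
  have Dj : D 0 j != 0.
    by apply: contraNneq ji => Dj; apply/eqP/D1; rewrite inE /= ?Dj ?Di.
  by rewrite !supp // mulr0.
move=> v; have := xy (enum_rank c); have := xy (enum_rank v).
rewrite !mxE !enum_rankK /f connect0 => Ev Ec; move: Ev; rewrite -Ec.
by case: (connect _ _ v) => // /eqP; rewrite eq_sym oner_eq0.
Qed.
End Spectral.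

(** * Traces of powers of S - A when A reverses a bipartition *)

Section TraceWords.
Variables (R : pzRingType) (V : numFieldType) (tau : {additive R -> V}).
Hypothesis tauC : forall x y, tau (x * y) = tau (y * x).
Variables s a j : R.
Hypotheses (jj : j * j = 1) (js : s * j = j * s) (ja : a * j = - (j * a)).

(** Conjugation by the involution [j] fixes [s] and negates [a]. *)
Lemma tau_flip k : tau ((s - a) ^+ k) = tau ((s + a) ^+ k).
Proof.
have E : (s - a) ^+ k * j = j * (s + a) ^+ k.
  elim: k => [|k IH]; first by rewrite !expr0 mul1r mulr1.
  by rewrite exprS -mulrA IH mulrA mulrBl js ja opprK -mulrDr -mulrA -exprS.
by rewrite -[LHS](congr1 tau (mulr1 _)) -jj mulrA E -mulrA tauC -mulrA jj mulr1.
Qed.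

(** Adding the expansions of the two powers cancels all words with an odd number of letters [a]. *)
Lemma tau_even k x :
  tau ((s - a) ^+ k) + tau ((s + a) ^+ k) = x *+ 2 -> tau ((s - a) ^+ k) = x.
Proof.
rewrite -tau_flip -mulr2n => E; have V2 : 2%:R != 0 :> V by rewrite pnatr_eq0.
by apply: (mulIf V2); rewrite !mulr_natr.
Qed.

Lemma tau2 : tau ((s - a) ^+ 2) = tau (s * s) + tau (a * a).
Proof.
apply: tau_even; rewrite !expr2 !(mulrDl, mulrDr, mulrN, mulNr, opprD, opprK) !(raddfD, raddfN) /=.
ring.
Qed.

Lemma tau3 : tau ((s - a) ^+ 3) = tau (s * (s * s)) + 3%:R * tau (s * (a * a)).
Proof.
(* Cyclic rotation identifies the words that form the same necklace. *)
have rot x y z : tau (x * (y * z)) = tau (y * (z * x)) by rewrite tauC -!mulrA.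
apply: tau_even; rewrite !exprS expr0 !mulr1 !(mulrDl, mulrDr, mulrN, mulNr, opprD, opprK) !(raddfD, raddfN) /=.
rewrite (rot a a s) (rot a s a).
ring.
Qed.

Lemma tau4 : tau ((s - a) ^+ 4) =
  tau (s * (s * (s * s))) + 4%:R * tau (s * (s * (a * a))) + 2%:R * tau (s * (a * (s * a)))
  + tau (a * (a * (a * a))).
Proof.
have rot x y z t : tau (x * (y * (z * t))) = tau (y * (z * (t * x))) by rewrite tauC -!mulrA.
apply: tau_even; rewrite !exprS expr0 !mulr1 !(mulrDl, mulrDr, mulrN, mulNr, opprD, opprK) !(raddfD, raddfN) /=.
rewrite (rot s a a s) (rot a a s s) (rot a s s a) (rot a s a s).
ring.
Qed.

Lemma tau5 : tau ((s - a) ^+ 5) =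
  tau (s * (s * (s * (s * s)))) + 5%:R * tau (s * (s * (s * (a * a))))
  + 5%:R * tau (s * (s * (a * (s * a)))) + 5%:R * tau (s * (a * (a * (a * a)))).
Proof.
have rot x y z t u : tau (x * (y * (z * (t * u)))) = tau (y * (z * (t * (u * x)))).
  by rewrite tauC -!mulrA.
apply: tau_even; rewrite !exprS expr0 !mulr1 !(mulrDl, mulrDr, mulrN, mulNr, opprD, opprK) !(raddfD, raddfN) /=.
rewrite (rot s s a a s) (rot s a a s s) (rot a a s s s) (rot a s s s a).
rewrite (rot s a s a s) (rot a s a s s) (rot s a s s a) (rot a s s a s).
rewrite (rot a a a a s) (rot a a a s a) (rot a a s a a) (rot a s a a a).
ring.
Qed.
End TraceWords.


Section MatrixTraces.
Variables (n : nat) (S A J : 'M[algC]_n).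
Hypotheses (JJ : J *m J = 1%:M) (SJ : S *m J = J *m S) (AJ : A *m J = - (J *m A)).

Let trC (B C : 'M[algC]_n) : \tr (B *m C) = \tr (C *m B) := mxtrace_mulC B C.

Lemma mxtrace2 : \tr ((S - A) ^+ 2) = \tr (S *m S) + \tr (A *m A).
Proof. exact: (tau2 (tau := @mxtrace algC n) trC JJ SJ AJ). Qed.

Lemma mxtrace3 :
  \tr ((S - A) ^+ 3) = \tr (S *m (S *m S)) + 3%:R * \tr (S *m (A *m A)).
Proof. exact: (tau3 (tau := @mxtrace algC n) trC JJ SJ AJ). Qed.

Lemma mxtrace4 : \tr ((S - A) ^+ 4) =
  \tr (S *m (S *m (S *m S))) + 4%:R * \tr (S *m (S *m (A *m A)))
  + 2%:R * \tr (S *m (A *m (S *m A))) + \tr (A *m (A *m (A *m A))).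
Proof. exact: (tau4 (tau := @mxtrace algC n) trC JJ SJ AJ). Qed.

Lemma mxtrace5 : \tr ((S - A) ^+ 5) =
  \tr (S *m (S *m (S *m (S *m S)))) + 5%:R * \tr (S *m (S *m (S *m (A *m A))))
  + 5%:R * \tr (S *m (S *m (A *m (S *m A)))) + 5%:R * \tr (S *m (A *m (A *m (A *m A)))).
Proof. exact: (tau5 (tau := @mxtrace algC n) trC JJ SJ AJ). Qed.
End MatrixTraces.

(** Centring at 2 makes the inner vertices of paths weigh 0, and degrees 1, 2, 3 give -1, 0, 1, the
    roots of s^3 = s. *)
Definition excess (G : sgraph) (u : G) : algC := (degree u)%:R - 2%:R.

(** * Moments of the shifted Laplacian of a tree, in terms of degrees *)

Section LaplacianTraces.
Variable G : sgraph.
Local Notation N := (laplacian algC G - 2%:R%:M).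
Local Notation s := (@excess G).
Local Notation e := (fun u v : G => (edge u v)%:R : algC).

Definition vdiag (f : G -> algC) := vmx (fun u v : G => (u == v)%:R * f u).

Lemma mul_vdiag f (K : G -> G -> algC) : vdiag f *m vmx K = vmx (fun u v => f u * K u v).
Proof.
rewrite mul_vmx; apply/matrixP=> i j; rewrite !mxE.
under eq_bigr => u _ do rewrite -mulrA eq_sym.
by rewrite sum_delta.
Qed.

Lemma vdiag_mul f g : vdiag f *m vdiag g = vdiag (fun u => f u * g u).
Proof.
by rewrite mul_vdiag; apply/matrixP=> i j; rewrite !mxE mulrCA.
Qed.

Lemma trace_vdiag f : \tr (vdiag f) = \sum_u f u.
Proof. by rewrite trace_vmx; apply: eq_bigr => u _; rewrite eqxx mul1r. Qed.

Lemma laplacian_shift : N = vdiag s - vmx e.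
Proof.
rewrite laplacian_vmx; apply/matrixP=> i j; rewrite !mxE (inj_eq enum_val_inj).
by rewrite /excess; case: (eqVneq i j) => [->|_]; rewrite ?mulr1n ?mulr0n; ring.
Qed.

Lemma sum_edge u : \sum_v e u v = (degree u)%:R.
Proof.
by rewrite /degree card_set_sum natr_sum; apply: eq_bigr => v _; rewrite inE.
Qed.

Lemma edge_sq u v : e u v * e v u = e u v.
Proof. by rewrite /= [edge v u]edge_sym; case: (edge u v); rewrite ?mulr1 ?mulr0. Qed.

Lemma trace1 : \tr N = \sum_u s u.
Proof.
rewrite laplacian_shift linearB /= trace_vdiag trace_vmx [X in _ - X]big1 ?subr0 // => u _.
by rewrite edge_irr.
Qed.

Variables (c : G) (d : G -> nat) (par : G -> G).
Hypothesis Gr : rooted c d par.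

(** A tree has no 4-cycle; the parent relations around one would contradict the depths. *)
Lemma common_neighbor (u v w w' : G) : u != v ->
  edge u w -> edge w v -> edge u w' -> edge w' v -> w = w'.
Proof.
move=> uv; rewrite !Gr.2.
have dE x : x != c -> d x = (d (par x)).+1 by apply: Gr.1.
by move=> /orP[]/andP[h1 /eqP E1] /orP[]/andP[h2 /eqP E2] /orP[]/andP[h3 /eqP E3] /orP[]/andP[h4 /eqP E4];
  have D1 := dE _ h1; have D2 := dE _ h2; have D3 := dE _ h3; have D4 := dE _ h4;
  rewrite -E1 in D1; rewrite -E2 in D2; rewrite -E3 in D3; rewrite -E4 in D4;
  try (exfalso; lia); try (by rewrite ?E1 ?E3); try (by rewrite ?E2 ?E4);
  try (by move: uv; rewrite E1 E2 eqxx); by move: uv; rewrite E3 E4 eqxx.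
Qed.

Let A := vmx e.
Let J := vdiag (fun u => (-1) ^+ d u).

(** [J] is the sign of the bipartition by parity of depth, and each edge joins opposite parities. *)
Lemma sign_vdiag : [/\ J *m J = 1%:M, vdiag s *m J = J *m vdiag s & A *m J = - (J *m A)].
Proof.
have JA : J *m A = vmx (fun u v => (-1) ^+ d u * e u v) by rewrite mul_vdiag.
split; rewrite ?vdiag_mul.
- apply/matrixP=> i j; rewrite !mxE -expr2 sqrr_sign mulr1 (inj_eq enum_val_inj).
  by case: (i == j).
- by apply/matrixP=> i j; rewrite !mxE; congr (_ * _); rewrite mulrC.
rewrite JA mul_vmx; apply/matrixP=> i j; rewrite !mxE.
under eq_bigr => w _ do rewrite mulrCA.
rewrite sum_delta; case: (boolP (edge _ _)) => [/(rooted_odd Gr) E|_]; last first.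
  by rewrite mul0r mulr0 oppr0.
by rewrite mul1r mulr1 -signr_odd -[in RHS]signr_odd E signrN opprK.
Qed.

Lemma trace_word k x :
  (forall S B C : 'M[algC]_#|G|, C * C = 1 -> S * C = C * S -> B * C = - (C * B) ->
     S = vdiag s -> B = A -> \tr ((S - B) ^+ k) = x) -> \tr (N ^+ k) = x.
Proof.
move=> E; have [JJ JS JA] := sign_vdiag; rewrite laplacian_shift; exact: (E _ _ J).
Qed.

Let b u v : algC := \sum_w e u w * e w v.

(** [b u v] counts walks of length two. Off the diagonal it is 0 or 1 by [common_neighbor], hence
    equal to its square, and the sum over [v] of [b u v] adds the degrees of the neighbours of
    [u]. *)
Lemma sum_sqr_b u : \sum_v b u v * b v u =
  (degree u)%:R ^+ 2 - (degree u)%:R + \sum_(v | edge u v) (degree v)%:R.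
Proof.
have bC v : b v u = b u v.
  by apply: eq_bigr => w _ /=; rewrite mulrC edge_sym [edge v w]edge_sym.
have buu : b u u = (degree u)%:R.
  by rewrite -sum_edge; apply: eq_bigr => w _; rewrite edge_sq.
have b01 v : u != v -> b u v * b u v = b u v.
  move=> uv; rewrite /b; have [/existsP[w /andP[uw wv]]|no] := boolP [exists w, edge u w && edge w v].
    rewrite (bigD1 w) //= big1 ?addr0 ?uw ?wv ?mulr1 // => w' w'w.
    rewrite -natrM mulnb; case: (boolP (_ && _)) => // /andP[uw' w'v].
    by rewrite (common_neighbor uv uw wv uw' w'v) eqxx in w'w.
  rewrite big1 ?mulr0 // => w _ /=; rewrite -natrM mulnb.
  by move: no; rewrite negb_exists => /forallP/(_ w)/negbTE ->.
have sumb : \sum_v b u v = \sum_(v | edge u v) (degree v)%:R.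
  rewrite /b exchange_big /= [RHS]big_mkcond; apply: eq_bigr => w _.
  by rewrite -mulr_sumr sum_edge; case: (edge u w); rewrite ?mul1r ?mul0r.
rewrite (bigD1 u) //= -sumb [in RHS](bigD1 u) //= buu.
rewrite (eq_bigr (fun v => b u v)) => [|v vu]; last by rewrite bC b01 // eq_sym.
ring.
Qed.

Lemma sum_edge2 (f g : G -> algC) :
  \sum_u f u * (\sum_v e u v * (g v * e v u)) = \sum_u \sum_(v | edge u v) f u * g v.
Proof.
apply: eq_bigr => u _; rewrite mulr_sumr [RHS]big_mkcond; apply: eq_bigr => v _ /=.
by rewrite [edge v u]edge_sym; case: (edge u v); rewrite ?(mul1r, mulr1, mul0r, mulr0).
Qed.

Let degE u : (degree u)%:R = s u + 2%:R :> algC. Proof. by rewrite subrK. Qed.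

Lemma sum_deg (f : G -> algC) :
  \sum_u f u * (\sum_v e u v * e v u) = \sum_u f u * (s u + 2%:R).
Proof.
apply: eq_bigr => u _; congr (_ * _); rewrite -degE -sum_edge.
by apply: eq_bigr => v _; rewrite edge_sq.
Qed.

Let X := \sum_u \sum_(v | edge u v) s u * s v.
Let Y := \sum_u \sum_(v | edge u v) s u ^+ 2 * s v.
Let p k := \sum_u s u ^+ k.


Let S := vdiag s.

Lemma trace_mulA4 :
  [/\ \tr (A *m A) = \sum_u (s u + 2%:R),
     \tr (A *m (A *m (A *m A))) = \sum_u (2%:R * (s u + 2%:R) ^+ 2 - (s u + 2%:R)) &
     \tr (S *m (A *m (A *m (A *m A)))) =
       \sum_u s u * ((s u + 2%:R) ^+ 2 - (s u + 2%:R)) + (X + 2%:R * (p 2 + 2%:R * p 1))].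
Proof.
have AA : A *m A = vmx b by rewrite mul_vmx.
have A4 : A *m (A *m (A *m A)) = vmx (fun u v => \sum_w b u w * b w v).
  by rewrite mulmxA AA mul_vmx.
split.
- rewrite AA trace_vmx; apply: eq_bigr => u _; rewrite -degE -sum_edge.
  by apply: eq_bigr => v _; rewrite edge_sq.
- rewrite A4 trace_vmx.
  under eq_bigr => u _ do rewrite sum_sqr_b.
  rewrite big_split /=.
  have -> : \sum_(u : G) \sum_(v | edge u v) (degree v)%:R = \sum_(u : G) (degree u)%:R ^+ 2 :> algC; last first.
    by rewrite -big_split /=; apply: eq_bigr => u _; rewrite degE; ring.
  rewrite (exchange_big_dep xpredT) //=; apply: eq_bigr => v _.
  rewrite expr2 -{3}sum_edge mulr_sumr [LHS]big_mkcond; apply: eq_bigr => u _ /=.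
  by rewrite edge_sym; case: (edge v u); rewrite ?mulr1 ?mulr0.
rewrite A4 mul_vdiag trace_vmx.
under eq_bigr => u _ do rewrite sum_sqr_b mulrDr degE.
rewrite big_split /=; congr (_ + _).
have -> : 2%:R * (p 2 + 2%:R * p 1) = \sum_u \sum_(v | edge u v) s u * 2%:R.
  rewrite /p !(mulrDr, mulr_sumr) -big_split; apply: eq_bigr => u _ /=.
  rewrite [RHS](_ : _ = s u * 2%:R * (degree u)%:R); last first.
    rewrite -sum_edge mulr_sumr [LHS]big_mkcond; apply: eq_bigr => v _ /=.
    by case: (edge u v); rewrite ?mulr1 ?mulr0.
  by rewrite degE; ring.
rewrite /X -big_split; apply: eq_bigr => u _ /=; rewrite mulr_sumr -big_split.
by apply: eq_bigr => v _ /=; rewrite degE mulrDr.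
Qed.

Lemma trace_mulSA f g :
  \tr (vdiag f *m (A *m (vdiag g *m A))) = \sum_u \sum_(v | edge u v) f u * g v.
Proof. by rewrite mul_vdiag mul_vmx mul_vdiag trace_vmx sum_edge2. Qed.

Lemma trace_mulA2 f : \tr (vdiag f *m (A *m A)) = \sum_u f u * (s u + 2%:R).
Proof. by rewrite mul_vmx mul_vdiag trace_vmx sum_deg. Qed.


Lemma trace2 : \tr (N ^+ 2) = p 2 + (p 1 + 2%:R * p 0).
Proof.
have [JJ JS JA] := sign_vdiag; have [trA2 _ _] := trace_mulA4.
rewrite laplacian_shift (mxtrace2 JJ JS JA).
rewrite trA2 !vdiag_mul trace_vdiag /p mulr_sumr -!big_split.
by apply: eq_bigr => u _ /=; ring.
Qed.

Lemma trace3 : \tr (N ^+ 3) = p 3 + 3%:R * (p 2 + 2%:R * p 1).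
Proof.
have [JJ JS JA] := sign_vdiag.
rewrite laplacian_shift (mxtrace3 JJ JS JA).
rewrite trace_mulA2 !vdiag_mul trace_vdiag /p.
rewrite !(mulrDr, mulr_sumr) -!big_split.
by apply: eq_bigr => u _ /=; ring.
Qed.

Lemma trace4 : \tr (N ^+ 4) =
  p 4 + 4%:R * p 3 + 10%:R * p 2 + 7%:R * p 1 + 6%:R * p 0 + 2%:R * X.
Proof.
have [JJ JS JA] := sign_vdiag; have [_ trA4 _] := trace_mulA4.
rewrite laplacian_shift (mxtrace4 JJ JS JA).
rewrite trA4 trace_mulSA [S *m (S *m (A *m A))]mulmxA !vdiag_mul trace_mulA2 trace_vdiag.
rewrite addrAC; congr (_ + 2%:R * _).
rewrite /p !mulr_sumr -!big_split.
by apply: eq_bigr => u _ /=; ring.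
Qed.

Lemma trace5 : \tr (N ^+ 5) =
  p 5 + 5%:R * p 4 + 15%:R * p 3 + 25%:R * p 2 + 30%:R * p 1 + 5%:R * (X + Y).
Proof.
have [JJ JS JA] := sign_vdiag; have [_ _ trA5] := trace_mulA4.
rewrite laplacian_shift (mxtrace5 JJ JS JA).
rewrite trA5 ![S *m (S *m _)]mulmxA !vdiag_mul trace_mulSA.
rewrite [_ *m (S *m (A *m A))]mulmxA !vdiag_mul trace_mulA2 trace_vdiag.
have -> : \sum_u \sum_(v | edge u v) s u * s u * s v = Y by [].
set Q1 := \sum_u _; set Q2 := \sum_u _; set Q3 := \sum_u _.
suff -> : Q1 = p 5 + 5%:R * p 4 + 15%:R * p 3 + 25%:R * p 2 + 30%:R * p 1
   - 5%:R * Q2 - 5%:R * (Q3 + 2%:R * (p 2 + 2%:R * p 1)) by ring.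
rewrite /Q1 /Q2 /Q3 /p !(mulr_sumr, mulrDr, =^~ big_split, =^~ sumrN).
by apply: eq_bigr => u _ /=; ring.
Qed.

Lemma power_sum0 : p 0 = #|G|%:R.
Proof. by rewrite /p -sum1_card natr_sum; apply: eq_bigr => u _; rewrite expr0. Qed.

End LaplacianTraces.

(** Induction from the deepest vertices upwards: the children of [v] share its value, and cancelling
    them in the equation at [v] leaves [f v = f (par v)]. *)
Lemma rooted_harmonic (G : sgraph) (c : G) d par (R : comNzRingType) (f : G -> R) :
    rooted c d par ->
    (forall v, (degree v)%:R * f v = \sum_(u | edge v u) f u) ->
  forall v, f v = f c.
Proof.
move=> Gr fE.
have step v : v != c -> f v = f (par v).
  have [k] := ubnP ((\sum_u d u) - d v); elim: k v => // k IH v dv vc.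
  have := fE v; rewrite (rooted_sum Gr) (rooted_degree Gr) vc natrD mulrDl mul1r.
  rewrite (eq_bigr (fun=> f v)) => [|u /andP[uc /eqP vu]].
    rewrite sumr_const mulr_natl (_ : #|[set _ | _]| = #|[pred u | (u != c) && (v == par u)]|).
      by move/addIr.
    by apply: eq_card => u; rewrite !inE.
  rewrite [in RHS]vu; apply: IH => //.
  have du : d u = (d v).+1 by rewrite vu; apply: Gr.1.
  have le_d : (d u <= \sum_w d w)%N by rewrite (bigD1 u) //= leq_addr.
  by move: dv; rewrite du in le_d *; lia.
by apply: (rooted_ind Gr) => // v vc <-; apply: step.
Qed.

(** * A graph cospectral with a tree is a tree *)

Section SameSpectrum.
Variables G H : sgraph.
Hypothesis GH : same_laplacian_spectrum H G.

Lemma same_card : #|H| = #|G|.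
Proof. by rewrite -(size_spectrum (laplacian algC H)) (perm_size GH) size_spectrum. Qed.

Lemma same_det x : \det (x%:M - laplacian algC H) = \det (x%:M - laplacian algC G).
Proof. by rewrite !det_spectrum; apply: perm_big. Qed.

Lemma same_trace k :
  \tr ((laplacian algC H - 2%:R%:M) ^+ k) = \tr ((laplacian algC G - 2%:R%:M) ^+ k).
Proof. by rewrite !trace_spectrum; apply: perm_big. Qed.

Variables (c : G) (d : G -> nat) (par : G -> G).
Hypothesis Gr : rooted c d par.

(** The kernel for the tree [G] is the line of constants, so 0 occurs at most once in the common
    spectrum. *)
Lemma same_connected : connected H.
Proof.
apply: spectrum0_connected; rewrite (seq.permP GH); apply: spectrum0_le1 => psi psiL.
have E : psi = \row_i psi 0 (enum_rank (enum_val i : G)).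
  by apply/rowP=> i; rewrite mxE enum_valK.
exists (psi 0 (enum_rank c)); apply/rowP=> i; rewrite [RHS]mxE -(enum_valK i).
apply: (rooted_harmonic (f := fun v => psi 0 (enum_rank v)) Gr).
by apply/(laplacian_kerP (fun v => psi 0 (enum_rank v))); rewrite -E.
Qed.

Lemma same_power1 : \sum_(u : H) excess u = \sum_(u : G) excess u.
Proof. by have := same_trace 1; rewrite !expr1 !trace1. Qed.

Lemma same_sum_degree : (\sum_(v : H) degree v)%N = (2 * #|H|.-1)%N.
Proof.
rewrite same_card -(rooted_sum_degree Gr); apply/eqP; rewrite -(eqr_nat algC) !natr_sum.
have := same_power1; rewrite /excess !sumrB !sumr_const.
by rewrite (eq_card (B := H)) // [in RHS](eq_card (B := G)) // same_card => /addIr ->.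
Qed.

Lemma same_rooted (z : H) : exists d' par', rooted z d' par' /\ d' z = 0%N.
Proof. exact: connected_rooted same_connected same_sum_degree. Qed.
End SameSpectrum.

(** * Degrees and leaves of a graph cospectral with a subcubic tree *)

Definition subcubic (G : sgraph) := forall v : G, (0 < degree v <= 3)%N.

Lemma excess_cases (G : sgraph) (v : G) : (0 < degree v <= 3)%N ->
  [\/ degree v = 1%N /\ excess v = -1, degree v = 2%N /\ excess v = 0 |
      degree v = 3%N /\ excess v = 1].
Proof.
rewrite /excess; case: (degree v) => [|[|[|[|k]]]] // _.
- by constructor 1; split=> //; ring.
- by constructor 2; split=> //; ring.
by constructor 3; split=> //; ring.
Qed.

Definition leaves (G : sgraph) := [set v : G | degree v == 1%N].
Definition branches (G : sgraph) := [set v : G | degree v == 3%N].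

Lemma subcubic_power1 (G : sgraph) : subcubic G ->
  \sum_(u : G) excess u = #|branches G|%:R - #|leaves G|%:R.
Proof.
move=> Gs; rewrite !card_set_sum !natr_sum -sumrB; apply: eq_bigr => u _; rewrite !inE.
by have [[-> ->]|[-> ->]|[-> ->]] := excess_cases (Gs u) => /=; ring.
Qed.

Lemma subcubic_power2 (G : sgraph) : subcubic G ->
  \sum_(u : G) excess u ^+ 2 = #|branches G|%:R + #|leaves G|%:R.
Proof.
move=> Gs; rewrite !card_set_sum !natr_sum -big_split; apply: eq_bigr => u _; rewrite !inE.
by have [[-> ->]|[-> ->]|[-> ->]] := excess_cases (Gs u) => /=; ring.
Qed.

Lemma subcubic_power (G : sgraph) k : subcubic G ->
  \sum_(u : G) excess u ^+ k.+3 = \sum_(u : G) excess u ^+ k.+1.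
Proof.
move=> Gs; apply: eq_bigr => u _; rewrite !exprS.
by have [[_ ->]|[_ ->]|[_ ->]] := excess_cases (Gs u); ring.
Qed.

(* Only the leaves contribute, because [s (1 - s)] vanishes for [s = 0, 1]. *)
Lemma subcubic_edge_sum (G : sgraph) : subcubic G ->
  \sum_(u : G) \sum_(v | edge u v) excess u * excess v -
  \sum_(u : G) \sum_(v | edge u v) excess u ^+ 2 * excess v =
  2%:R * (\sum_(u in leaves G) \sum_(v | edge u v) (3 - degree v)%:R - #|leaves G|%:R).
Proof.
move=> Gs; rewrite -sumrB.
have -> : #|leaves G|%:R = \sum_(u in leaves G) \sum_(v | edge u v) 1 :> algC.
  rewrite -sum1_card natr_sum; apply: eq_bigr => u; rewrite inE => /eqP du.
  rewrite sumr_const (_ : #|_| = 1%N) // -du.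
  by apply: eq_card => v; rewrite inE.
rewrite -sumrB mulr_sumr [RHS]big_mkcond; apply: eq_bigr => u _; rewrite -sumrB inE.
rewrite -sumrB mulr_sumr.
have [[-> ->]|[-> ->]|[-> ->]] := excess_cases (Gs u) => /=; last 2 first.
- by rewrite big1 // => v _; ring.
- by rewrite big1 // => v _; ring.
apply: eq_bigr => v _; have [[-> ->]|[-> ->]|[-> ->]] := excess_cases (Gs v).
- by rewrite -[(3 - 1)%N]/2%N; ring.
- by rewrite -[(3 - 2)%N]/1%N; ring.
by rewrite -[(3 - 3)%N]/0%N; ring.
Qed.

Section SameSpectrumSubcubic.
Variables G H : sgraph.
Hypothesis GH : same_laplacian_spectrum H G.
Variables (c : G) (d : G -> nat) (par : G -> G).
Hypotheses (Gr : rooted c d par) (Gs : subcubic G) (G1 : (1 < #|G|)%N).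

Lemma same_power2 : \sum_(u : H) excess u ^+ 2 = \sum_(u : G) excess u ^+ 2.
Proof.
have /card_gt0P[z _] : (0 < #|H|)%N by rewrite (same_card GH) ltnW.
have [dz [parz [Hr _]]] := same_rooted GH Gr z.
have := same_trace GH 2; rewrite (trace2 Hr) (trace2 Gr) !power_sum0 (same_card GH).
have := same_power1 GH; under eq_bigr => u _ do rewrite -[excess u]expr1.
by under [in RHS]eq_bigr => u _ do rewrite -[excess u]expr1; move=> -> /addIr.
Qed.

Lemma same_power3 : \sum_(u : H) excess u ^+ 3 = \sum_(u : G) excess u ^+ 3.
Proof.
have /card_gt0P[z _] : (0 < #|H|)%N by rewrite (same_card GH) ltnW.
have [dz [parz [Hr _]]] := same_rooted GH Gr z.
have := same_trace GH 3; rewrite (trace3 Hr) (trace3 Gr) same_power2.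
have := same_power1 GH; under eq_bigr => u _ do rewrite -[excess u]expr1.
by under [in RHS]eq_bigr => u _ do rewrite -[excess u]expr1; move=> -> /addIr.
Qed.

Lemma connected_degree_gt0 (K : sgraph) (v : K) :
  connected K -> (1 < #|K|)%N -> (0 < degree v)%N.
Proof.
move=> Kc K1; rewrite lt0n; apply/eqP => /eqP; rewrite /degree cards_eq0 => /eqP dv.
have Ev w : w = v.
  move: w; apply: (connected_ind (c := v) Kc) => // x y xy xv.
  have : y \in [set w | edge v w] by rewrite inE -xv.
  by rewrite dv inE.
by move: K1; rewrite (eq_card (B := pred1 v)) ?card1 // => w; rewrite !inE [w]Ev eqxx.
Qed.

(* [(d - 1)(d - 2)(d - 3)] is nonnegative on positive integers and sums to 0. *)
Lemma same_subcubic : subcubic H.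
Proof.
have H1 : (1 < #|H|)%N by rewrite (same_card GH).
have dpos (v : H) := connected_degree_gt0 v (same_connected GH Gr) H1.
have s0 : (\sum_(v : H) (degree v).-1 * (degree v - 2) * (degree v - 3))%N == 0%N.
  rewrite -(eqr_nat algC) natr_sum; apply/eqP.
  transitivity (\sum_(u : H) excess u ^+ 3 - \sum_(u : H) excess u).
    rewrite -sumrB; apply: eq_bigr => v _; rewrite /excess.
    move: (dpos v); case: (degree v) => [|[|[|k]]] // _.
    - by rewrite -[X in X%:R = _]/0%N; ring.
    - by rewrite -[X in X%:R = _]/0%N; ring.
    rewrite (_ : (k.+3).-1 * (k.+3 - 2) * (k.+3 - 3) = (k + 2) * (k + 1) * k)%N; last lia.
    by rewrite !natrM !natrD -addn3 natrD; ring.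
  rewrite same_power3 (same_power1 GH) (subcubic_power 0 Gs).
  by rewrite [X in _ - X](eq_bigr (fun u => excess u ^+ 1)) ?subrr // => u _; rewrite expr1.
move=> v; rewrite dpos /=; move: s0; rewrite sum_nat_eq0 => /forallP/(_ v) /=.
by rewrite !muln_eq0 => /orP[/orP[]|]; move: (dpos v); lia.
Qed.

(** The first two power sums of the excess are the difference and the sum of the numbers of branches
    and leaves. *)
Lemma same_leaves : #|leaves H| = #|leaves G|.
Proof.
have E1 := same_power1 GH; have E2 := same_power2.
rewrite !subcubic_power1 // in E1; last exact: same_subcubic.
rewrite !subcubic_power2 // in E2; last exact: same_subcubic.
have E : 2%:R * #|leaves H|%:R = 2%:R * #|leaves G|%:R :> algC.
  transitivity ((#|branches H|%:R + #|leaves H|%:R) - (#|branches H|%:R - #|leaves H|%:R) : algC).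
    by ring.
  by rewrite E1 E2; ring.
by apply/eqP; rewrite -(eqr_nat algC); apply/eqP; apply: mulfI E; rewrite pnatr_eq0.
Qed.

(** Given the power sums, moment 4 determines the edge sum of s_u s_v, and moment 5 then that of
    s_u^2 s_v. By [subcubic_edge_sum] their difference measures the total of 3 - deg over neighbours
    of leaves, a sum of natural numbers that vanishes for [G], hence for [H]. *)
Lemma same_leaf_neighbors :
    (forall u v : G, edge u v -> degree u = 1%N -> degree v = 3%N) ->
  forall u v : H, edge u v -> degree u = 1%N -> degree v = 3%N.
Proof.
move=> Gl; have /card_gt0P[z _] : (0 < #|H|)%N by rewrite (same_card GH) ltnW.
have [dz [parz [Hr _]]] := same_rooted GH Gr z.
have Hs := same_subcubic.
have p1 : \sum_(u : H) excess u ^+ 1 = \sum_(u : G) excess u ^+ 1.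
  have := same_power1 GH; under eq_bigr => u _ do rewrite -[excess u]expr1.
  by under [in RHS]eq_bigr => u _ do rewrite -[excess u]expr1.
have X4 := same_trace GH 4; rewrite (trace4 Hr) (trace4 Gr) in X4.
have Y5 := same_trace GH 5; rewrite (trace5 Hr) (trace5 Gr) in Y5.
rewrite !(subcubic_power _ Hs) !(subcubic_power _ Gs) p1 same_power2 ?power_sum0 ?(same_card GH) in X4 Y5.
have n2 : (2%:R : algC) != 0 by rewrite pnatr_eq0.
have n5 : (5%:R : algC) != 0 by rewrite pnatr_eq0.
have EX := mulfI n2 (addrI _ X4); have EY := mulfI n5 (addrI _ Y5).
rewrite EX in EY; have {}EY := addrI _ EY.
have := subcubic_edge_sum Hs; rewrite EX EY subcubic_edge_sum // same_leaves.
move=> /mulfI; rewrite pnatr_eq0 => /(_ isT) /addIr.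
rewrite big1 => [|u uG]; last first.
  rewrite big1 // => v uv; rewrite (Gl _ _ uv) //; by move: uG; rewrite inE => /eqP.
move=> /esym/eqP; under eq_bigr => u _ do rewrite -natr_sum.
rewrite -natr_sum pnatr_eq0 sum_nat_eq0 => /forallP L u v uv du.
move: (L u); rewrite inE du eqxx /= sum_nat_eq0 => /forallP/(_ v); rewrite uv /= => h.
by move: (Hs v); lia.
Qed.
End SameSpectrumSubcubic.

Lemma big_option (R : Type) (idx : R) (op : Monoid.com_law idx) (T : finType)
    (F : option T -> R) :
  \big[op/idx]_v F v = op (F None) (\big[op/idx]_x F (Some x)).
Proof.
rewrite (bigD1 None) //=; congr (op _ _).
by rewrite (reindex_omap Some id) => [|[]] //; apply: eq_bigl => x; rewrite /= eqxx.
Qed.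

(** * The tree T_4 as a rooted tree, and its determinant *)

Section T4Facts.
Variables p q r : nat.
Hypotheses (p_gt0 : (0 < p)%N) (q_gt0 : (0 < q)%N) (r_gt0 : (0 < r)%N).
Local Notation T := (T4_vertex p q r).
Local Notation l := (arm_length p q r).

Lemma arm_length_gt0 i : (0 < l i)%N.
Proof. by case: i => [[|[|[|]]]]. Qed.

(* The vertex at distance [k + 1] from the center on arm [i], or the center when
   [k] is too large. *)
Definition arm_vertex (i : 'I_3) (k : nat) : T :=
  omap (fun j : 'I_(l i) => inl (Tagged (fun i => 'I_(l i)) j)) (insub k).

Lemma arm_vertexE (x : {i : 'I_3 & 'I_(l i)}) :
  Some (inl x) = arm_vertex (tag x) (tagged x).
Proof. by case: x => i j; rewrite /arm_vertex valK. Qed.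

Lemma arm_vertexP i k : (k < l i)%N -> exists x : {i : 'I_3 & 'I_(l i)},
  [/\ arm_vertex i k = Some (inl x), tag x = i & tagged x = k :> nat].
Proof.
by move=> h; exists (Tagged (fun i => 'I_(l i)) (Ordinal h)); rewrite /arm_vertex insubT.
Qed.

Lemma arm_vertex_eq (x : {i : 'I_3 & 'I_(l i)}) i k : (k < l i)%N ->
  (Some (inl x) == arm_vertex i k) = (tag x == i) && (tagged x == k :> nat).
Proof.
move=> h; rewrite /arm_vertex insubT; apply/eqP/andP => [[->] //|[/eqP E /eqP Ek]].
case: x E Ek => i' j /= E; move: j; rewrite E => j Ej.
rewrite (_ : j = Ordinal h) //; exact: val_inj.
Qed.

Definition T4_depth (v : T) : nat :=
  match v with
  | None => 0
  | Some (inl x) => (tagged x).+1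
  | Some (inr ib) => (l ib.1).+1
  end.

Definition T4_parent (v : T) : T :=
  match v with
  | None => None
  | Some (inl x) => if nat_of_ord (tagged x) is k.+1 then arm_vertex (tag x) k else None
  | Some (inr ib) => arm_vertex ib.1 (l ib.1).-1
  end.

Lemma T4_arcE (u v : T) : T4_arc u v = (v != None) && (u == T4_parent v).
Proof.
case: v => [[y|[i b]]|]; last by case: u => [[]|].
  case: u => [[x|[i b]]|] /=.
  - case E: (tagged y : nat) => [|k]; first by rewrite andbF.
    rewrite arm_vertex_eq; last by rewrite ltnW // -E.
    by rewrite eqSS [k == _]eq_sym.
  - case: (tagged y : nat) (ltn_ord (tagged y)) => [|k] // h.
    by have [x [-> _ _]] := arm_vertexP (ltnW h).
  case: (tagged y : nat) (ltn_ord (tagged y)) => [|k] // h.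
  by have [x [-> _ _]] := arm_vertexP (ltnW h).
have h : ((l i).-1 < l i)%N by rewrite prednK ?arm_length_gt0.
case: u => [[x|[j b']]|] /=; try by have [x [-> _ _]] := arm_vertexP h.
rewrite arm_vertex_eq //; congr (_ && _).
by rewrite -{1}(prednK (arm_length_gt0 i)) eqSS.
Qed.

Lemma T4_rooted : rooted (None : T4 p q r) T4_depth T4_parent.
Proof.
split=> [[[x|[i b]]|] //= _|u v].
  case E: (tagged x : nat) => [|k] //.
  have h : (k < l (tag x))%N by rewrite ltnW // -E.
  by have [y [-> _ /= ->]] := arm_vertexP h.
  have h : ((l i).-1 < l i)%N by rewrite prednK ?arm_length_gt0.
  by have [y [-> _ /= ->]] := arm_vertexP h; rewrite prednK ?arm_length_gt0.
by rewrite -[edge u v]/(T4_arc u v || T4_arc v u) !T4_arcE.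
Qed.

Lemma big_T4 (R : Type) (idx : R) (op : Monoid.com_law idx) (F : T -> R) :
  \big[op/idx]_v F v = op (F None)
    (op (\big[op/idx]_i \big[op/idx]_(k < l i) F (arm_vertex i k))
        (\big[op/idx]_ib F (Some (inr ib)))).
Proof.
rewrite big_option big_sumType /= sig_big_dep; congr (op _ (op _ _)).
by apply: eq_bigr => x _; rewrite -arm_vertexE.
Qed.

Definition T4_children (v : T) : {set T} :=
  match v with
  | None => [set arm_vertex i 0 | i : 'I_3]
  | Some (inl x) => if (tagged x).+1 == l (tag x)
     then [set Some (inr (tag x, true)); Some (inr (tag x, false))]
     else [set arm_vertex (tag x) (tagged x).+1]
  | Some (inr _) => set0
  end.

Lemma T4_childrenE v : [set u | (u != None) && (v == T4_parent u)] = T4_children v.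
Proof.
apply/setP=> u; rewrite inE -T4_arcE; case: v => [[x|[i b]]|] /=.
- case: u => [[y|[i b]]|]; case: ifP => xl; rewrite !inE /= ?xl ?andbF ?andbT //.
  + apply/negbTE/negP => /andP[/eqP E /eqP F].
    by have := ltn_ord (tagged y); rewrite F (eqP xl) E ltnn.
  + have h : ((tagged x).+1 < l (tag x))%N by rewrite ltn_neqAle xl /= ltn_ord.
    by rewrite arm_vertex_eq //; congr (_ && _); apply: eq_sym.
  + have [<-|ne] /= := eqVneq (tag x) i; last first.
      apply/esym/negbTE; rewrite negb_or; apply/andP; split; apply/eqP => -[E];
        by rewrite E eqxx in ne.
    by rewrite xl; case: b; rewrite eqxx ?orbT.
  + have h : ((tagged x).+1 < l (tag x))%N by rewrite ltn_neqAle xl /= ltn_ord.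
    have [y [-> _ _]] := arm_vertexP h.
    by apply/negbTE; apply/negP => /andP[/eqP <-]; rewrite xl.
  + have h : ((tagged x).+1 < l (tag x))%N by rewrite ltn_neqAle xl /= ltn_ord.
    by have [y [-> _ _]] := arm_vertexP h.
- by case: u => [[y|[j b']]|]; rewrite inE.
case: u => [[y|[j b']]|] /=; apply/idP/imsetP.
- by move=> y0; exists (tag y) => //; apply/eqP; rewrite arm_vertex_eq ?arm_length_gt0 // eqxx.
- by case=> i _ /eqP; rewrite arm_vertex_eq ?arm_length_gt0 // => /andP[].
- by [].
- by case=> i _; have [x [-> _ _]] := arm_vertexP (arm_length_gt0 i).
- by [].
by case=> i _; have [x [-> _ _]] := arm_vertexP (arm_length_gt0 i).
Qed.

Lemma arm_vertex0_inj : injective (fun i => arm_vertex i 0).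
Proof.
move=> i j /eqP; have [x [-> <- _]] := arm_vertexP (arm_length_gt0 i).
by rewrite arm_vertex_eq ?arm_length_gt0 // => /andP[/eqP].
Qed.

Lemma card_T4_children v : #|T4_children v| =
  match v with
  | None => 3%N | Some (inl x) => ((tagged x).+1 == l (tag x)).+1 | Some (inr _) => 0%N end.
Proof.
case: v => [[x|ib]|] /=; last 2 first.
- exact: cards0.
- by rewrite card_imset ?card_ord //; exact: arm_vertex0_inj.
case: ((tagged x).+1 == _) => /=; rewrite ?cards2 ?cards1 //.
by rewrite (_ : _ != _) //; apply/eqP => -[].
Qed.

Lemma T4_degree (v : T4 p q r) : degree v =
  match v with
  | None => 3%N
  | Some (inl x) => ((tagged x).+1 == l (tag x)).+2
  | Some (inr _) => 1%N end.
Proof.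
rewrite (rooted_degree T4_rooted) T4_childrenE card_T4_children.
by case: v => [[x|ib]|].
Qed.

Lemma T4_subcubic : subcubic (T4 p q r).
Proof. by move=> v; rewrite T4_degree; case: v => [[x|ib]|] //; case: (_ == _). Qed.

Lemma T4_leaves : #|leaves (T4 p q r)| = 6%N.
Proof.
have -> : leaves (T4 p q r) = [set Some (inr ib) | ib : 'I_3 * bool].
  apply/setP=> v; rewrite inE T4_degree; case: v => [[x|ib]|] /=.
  - by apply/esym/negbTE/imsetP => -[].
  - by apply/esym/imsetP; exists ib.
  by apply/esym/negbTE/imsetP => -[].
rewrite card_imset; first by rewrite card_prod card_ord card_bool.
by move=> ? ? [].
Qed.

Lemma T4_leaf_neighbors (u v : T4 p q r) : edge u v -> degree u = 1%N -> degree v = 3%N.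
Proof.
rewrite !T4_degree; case: u => [[x|[i b]]|] //; rewrite -[edge _ _]/(T4_arc _ v || T4_arc v _) /=.
by case: v => [[y|[j b']]|] //= /andP[/eqP <- ->].
Qed.

Lemma card_T4 : #|T4 p q r| = (p + q + r + 7)%N.
Proof.
rewrite card_option card_sum card_tagged card_prod card_ord card_bool.
rewrite sumnE big_map big_enum !big_ord_recl big_ord0 /= !card_ord /arm_length /=; lia.
Qed.

(** Rooted at the center, [al] is the pivot of a pendant vertex and [g k] that of the arm vertex at
    distance [k] from the outer end of its arm; the same sequence serves all three arms. *)
Lemma T4_det (F : fieldType) (x al : F) (g : nat -> F) :
    al != 0 -> (forall k, g k != 0) ->
    al = x - 1 -> g 0%N = x - 3%:R - 2%:R / al -> (forall k, g k.+1 = x - 2%:R - (g k)^-1) ->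
  \det (x%:M - laplacian F (T4 p q r)) =
    (x - 3%:R - \sum_i (g (l i).-1)^-1) * ((\prod_i \prod_(k < l i) g k) * al ^+ 6).
Proof.
move=> al0 g_neq0 alE g0 gS.
pose f (v : T4 p q r) : F := match v with
  | None => x - 3%:R - \sum_i (g (l i).-1)^-1
  | Some (inl y) => g (l (tag y) - (tagged y).+1)%N
  | Some (inr _) => al end.
have fav i k : (k < l i)%N -> f (arm_vertex i k) = g (l i - k.+1)%N.
  by move=> h; rewrite /f /arm_vertex insubT.
rewrite (rooted_pivot (f := f) T4_rooted).
- rewrite big_T4 /=; congr (_ * (_ * _)).
    apply: eq_bigr => i _; rewrite [RHS](reindex_inj rev_ord_inj) /=.
    by apply: eq_bigr => k _; rewrite fav.
  by rewrite prodr_const card_prod card_ord card_bool.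
- by case=> [[y|ib]|] //= _; exact: g_neq0.
move=> v; rewrite (eq_bigl (fun u => u \in T4_children v)) => [|u]; last first.
  by rewrite -T4_childrenE inE.
rewrite T4_degree; case: v => [[y|ib]|] /=; last 2 first.
- by rewrite big_set0 subr0.
- congr (_ - _); rewrite big_imset /=; last by move=> ? ? _ _; apply: arm_vertex0_inj.
  by apply: eq_bigr => i _; rewrite fav ?arm_length_gt0 // subn1.
case: eqP => yl /=.
  rewrite yl subnn g0 big_setU1 ?inE /=; last by apply/eqP => -[].
  by rewrite big_set1 mulr_natl mulr2n.
have h : ((tagged y).+1 < l (tag y))%N by rewrite ltn_neqAle ltn_ord andbT; apply/eqP.
by rewrite big_set1 fav // -subnSK // gS subSS.
Qed.
End T4Facts.

Definition leaf_degree (G : sgraph) (v : G) := #|[set u | edge v u & degree u == 1%N]|.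

(** * Ancestors, leaves and non-leaf children in a tree rooted at a non-leaf *)

Section NonleafRoot.
Variables (G : sgraph) (c : G) (d : G -> nat) (par : G -> G).
Hypothesis Gr : rooted c d par.

Lemma iter_parent_depth k v : (k <= d v)%N -> d c = 0%N -> d (iter k par v) = (d v - k)%N.
Proof.
move=> + dc; elim: k => [|k IH] kv /=; first by rewrite subn0.
have kc : iter k par v != c.
  by apply/eqP => E; have := IH (ltnW kv); rewrite E dc; lia.
by have := Gr.1 _ kc; rewrite IH ?(ltnW kv) //; lia.
Qed.

Lemma depth_eq0 v : d v = 0%N -> v = c.
Proof. by move=> dv; apply/eqP; apply: contraPT dv => /Gr.1 ->. Qed.

Lemma iter_parent_root v : d c = 0%N -> iter (d v) par v = c.
Proof. by move=> dc; apply: depth_eq0; rewrite iter_parent_depth // subnn. Qed.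

Lemma iter_parent_neq k v : (k < d v)%N -> d c = 0%N -> iter k par v != c.
Proof.
move=> kv dc; apply/eqP => E; have := iter_parent_depth (ltnW kv) dc.
by rewrite E dc; lia.
Qed.

Hypothesis c_nonleaf : degree c != 1%N.

Definition children v := [set u | (u != c) && (v == par u)].
Definition nonleaf_children v := [set u in children v | degree u != 1%N].

Lemma mem_children u : u != c -> u \in children (par u).
Proof. by move=> uc; rewrite inE uc eqxx. Qed.

Lemma mem_nonleaf_children u : u != c -> degree u != 1%N ->
  u \in nonleaf_children (par u).
Proof. by move=> uc du; rewrite inE mem_children. Qed.

Lemma degree_children v : degree v = ((v != c) + #|children v|)%N.
Proof. exact: rooted_degree Gr v. Qed.

Lemma parent_nonleaf v : v != c -> degree (par v) != 1%N.
Proof.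
move=> vc; have [->//|pc] := eqVneq (par v) c.
have : (0 < #|children (par v)|)%N by apply/card_gt0P; exists v; apply: mem_children.
by rewrite degree_children pc; case: #|_|.
Qed.

(** No parent is a leaf, since the root is not one; so all leaves adjacent to [v] are children of
    [v]. *)
Lemma card_nonleaf_children v :
  degree v = ((v != c) + (#|nonleaf_children v| + leaf_degree v))%N.
Proof.
rewrite degree_children; congr addn.
rewrite -(cardsID [set u | degree u == 1%N] (children v)) addnC /leaf_degree.
congr addn; first by apply: eq_card => u; rewrite !inE andbC.
apply: eq_card => u; rewrite !inE; case: (eqVneq (degree u) 1%N) => [du|]; last by rewrite !andbF.
rewrite !andbT Gr.2; case: (boolP (u != c)) => [uc|/negPn/eqP E] /=; last first.
  by move: c_nonleaf; rewrite -E du.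
have [E|] := eqVneq u (par v); rewrite ?andbT ?andbF ?orbF //=.
case: (boolP (v != c)) => [vc|_]; last by rewrite orbF.
by have := parent_nonleaf vc; rewrite -E du.
Qed.

Lemma iter_parent_nonleaf k v : (k <= d v)%N -> d c = 0%N -> degree v != 1%N ->
  degree (iter k par v) != 1%N.
Proof.
case: k => // k kv dc _; exact/parent_nonleaf/iter_parent_neq.
Qed.
End NonleafRoot.

(** * How six leaves are distributed over the branch vertices *)

Section LeafCount.
Variable G : sgraph.
Hypotheses (Gc : connected G) (Gs : subcubic G) (G6 : #|leaves G| = 6%N).
Hypothesis sumd : (\sum_(v : G) degree v)%N = (2 * #|G|.-1)%N.
Hypothesis Gl : forall u v : G, edge u v -> degree u = 1%N -> degree v = 3%N.

(** For degrees 1, 2, 3, adding 1 to the degree of a leaf gives 2, plus 1 at a branch vertex;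
    summing against the total 2(n - 1) gives two fewer branches than leaves. *)
Lemma card_branches : #|branches G| = 4%N.
Proof.
have G0 : (0 < #|G|)%N.
  by have /card_gt0P[v _] : (0 < #|leaves G|)%N by [rewrite G6]; apply/card_gt0P; exists v.
have : (\sum_(v : G) degree v + #|leaves G| = 2 * #|G| + #|branches G|)%N.
  have -> : (2 * #|G| = \sum_(v : G) 2)%N by rewrite sum_nat_const mulnC.
  rewrite !card_set_sum -!big_split; apply: eq_bigr => v _; rewrite !inE /=.
  by have := Gs v; case: (degree v) => [|[|[|[|k]]]].
by rewrite sumd G6; lia.
Qed.

Lemma leaf_degree2 (v : G) : degree v = 2%N -> leaf_degree v = 0%N.
Proof.
move=> dv; apply/eqP; rewrite cards_eq0; apply/eqP/setP => u; rewrite !inE.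
apply/negbTE/negP => /andP[vu /eqP du].
by have := Gl (_ : edge u v) du; rewrite edge_sym vu dv => /(_ isT).
Qed.

(** Three leaves around [v] would exhaust the connected graph and leave [v] as the only branch
    vertex, against four. *)
Lemma leaf_degree3 (v : G) : degree v = 3%N -> (leaf_degree v <= 2)%N.
Proof.
move=> dv; rewrite leqNgt; apply/negP => l3.
have allleaf u : edge v u -> degree u = 1%N.
  have : [set u | edge v u & degree u == 1%N] == [set u | edge v u].
    rewrite eqEcard; apply/andP; split; first by apply/subsetP=> w; rewrite !inE => /andP[].
    by move: l3; rewrite -[#|[set u | edge v u]|]/(degree v) dv.
  by move=> /eqP/setP/(_ u); rewrite !inE; case: (edge v u) => //= /eqP.
have all_v w : w = v \/ edge v w.
  move: w; apply: (connected_ind (c := v) Gc); first by left.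
  move=> x y xy [xv|vx]; first by right; rewrite -xv.
  left; have := allleaf _ vx; rewrite /degree => /eqP/cards1P[w /setP W].
  have := W y; have := W v; rewrite !inE xy edge_sym vx => /esym/eqP -> /esym/eqP //.
have : branches G \subset [set v].
  apply/subsetP=> w; rewrite !inE => /eqP dw; have [->//|/allleaf] := all_v w.
  by rewrite dw.
by move=> /subset_leq_card; rewrite card_branches cards1.
Qed.

Lemma sum_leaf_degree : (\sum_(v in branches G) leaf_degree v = 6)%N.
Proof.
rewrite -G6 -sum1_card.
under eq_bigr => v _ do rewrite /leaf_degree -sum1dep_card.
rewrite (exchange_big_dep (mem (leaves G))) /=; last by move=> v u _ /andP[_ du]; rewrite inE.
apply: eq_bigr => u; rewrite inE => /eqP du; rewrite sum1dep_card -[RHS]du.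
apply: eq_card => v; rewrite !inE edge_sym du eqxx andbT.
case: (boolP (edge u v)) => uv; last by rewrite andbF.
by rewrite (Gl uv du) eqxx.
Qed.

Lemma sum_leaf_deficit : (\sum_(v in branches G) (2 - leaf_degree v) = 2)%N.
Proof.
have : (\sum_(v in branches G) (2 - leaf_degree v) + \sum_(v in branches G) leaf_degree v = 8)%N.
  rewrite -big_split /= (eq_bigr (fun=> 2%N)) ?sum_nat_const ?card_branches // => v.
  by rewrite inE => /eqP /leaf_degree3 /subnK.
by rewrite sum_leaf_degree; lia.
Qed.

(** The deficits 2 - [leaf_degree] of the branch vertices sum to 2: either one deficit is 2, or two
    are 1. *)
Lemma leaf_cases :
  (exists c : G, [/\ degree c = 3%N, leaf_degree c = 0%N &
     forall v : G, degree v = 3%N -> v != c -> leaf_degree v = 2%N]) \/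
  (exists y z : G, [/\ y != z, degree y = 3%N /\ degree z = 3%N,
     leaf_degree y = 1%N /\ leaf_degree z = 1%N &
     forall v : G, degree v = 3%N -> v != y -> v != z -> leaf_degree v = 2%N]).
Proof.
have [/existsP[c /andP[/eqP dc /eqP lc]]|no] :=
    boolP [exists c : G, (degree c == 3%N) && (leaf_degree c == 0%N)].
  left; exists c; split=> // v dv vc.
  have := sum_leaf_deficit; rewrite (bigD1 c) ?inE ?dc //= lc => /eqP.
  rewrite -[X in _ == X]addn0 eqn_add2l sum_nat_eq0 => /forallP/(_ v).
  by rewrite inE dv vc eqxx /= => h; have := leaf_degree3 dv; lia.
right; pose K := [set v in branches G | leaf_degree v == 1%N].
have l12 (v : G) : degree v = 3%N -> leaf_degree v = 1%N \/ leaf_degree v = 2%N.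
  move=> dv; have := leaf_degree3 dv; move: no; rewrite negb_exists => /forallP/(_ v).
  by rewrite dv eqxx /=; lia.
have /eqP/cards2P[y [z [yz K2]]] : #|K| = 2%N.
  rewrite -sum_leaf_deficit -sum1_card [RHS]big_mkcond [LHS]big_mkcond.
  apply: eq_bigr => v _; rewrite !inE; case: eqP => //= dv.
  by have [->|->] := l12 _ dv.
exists y, z; have : y \in K by rewrite K2 !inE eqxx.
have : z \in K by rewrite K2 !inE eqxx orbT.
rewrite !inE => /andP[/eqP dz /eqP lz] /andP[/eqP dy /eqP ly]; split=> // v dv vy vz.
have : v \notin K by rewrite K2 !inE negb_or vy.
by rewrite !inE dv eqxx /=; have [->|->] := l12 _ dv.
Qed.
End LeafCount.

(** * First shape: a branch vertex without leaves is the center of a T_4 *)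

Section Star.
Variables (G : sgraph) (c : G) (d : G -> nat) (par : G -> G).
Hypotheses (Gr : rooted c d par) (dc : d c = 0%N) (Gs : subcubic G).
Hypotheses (c3 : degree c = 3%N) (lc : leaf_degree c = 0%N).
Hypothesis l3 : forall v : G, degree v = 3%N -> v != c -> leaf_degree v = 2%N.
Hypothesis l2 : forall v : G, degree v = 2%N -> leaf_degree v = 0%N.
Hypothesis b4 : #|branches G| = 4%N.

Let c_nonleaf : degree c != 1%N. Proof. by rewrite c3. Qed.
Let cardNC := card_nonleaf_children Gr c_nonleaf.

(** Away from the root, a branch vertex spends both children on leaves and a vertex of degree 2 has
    a single child. *)
Lemma nonleaf_child_le1 (v u u' : G) : v != c -> u \in nonleaf_children c par v ->
  u' \in nonleaf_children c par v -> u = u'.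
Proof.
move=> vc; have : (#|nonleaf_children c par v| <= 1)%N.
  have := cardNC v; rewrite vc; have /andP[] := Gs v; case: (degree v) (l2 (v := v)) (l3 (v := v)) => [|[|[|[|]]]] //.
  - by move=> _ _ _ _; case: #|_|.
  - by move=> -> // _ _ _; lia.
  by move=> _ -> // _ _; lia.
by move=> /card_le1_eqP E uP u'P; apply: E.
Qed.

Lemma nonleaf_child_branch (v : G) : v != c -> degree v = 3%N ->
  nonleaf_children c par v = set0.
Proof.
move=> vc dv; apply/eqP; rewrite -cards_eq0.
by have := cardNC v; rewrite vc dv l3 //; lia.
Qed.

(** The outer ends of the arms. Their depths are the arm lengths, so sorting by depth gives P <= Q
    <= R. *)
Let caps := sort (relpre d leq) (enum [set v | (degree v == 3%N) && (v != c)]).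

Let size_caps : size caps = 3%N.
Proof.
rewrite size_sort -cardE; apply/eqP; rewrite -eqSS -b4 (cardsD1 c (branches G)) inE c3 eqxx.
by rewrite add1n eqSS; apply/eqP/eq_card => v; rewrite !inE andbC.
Qed.

Let cap (i : 'I_3) := nth c caps i.

Let capP i : degree (cap i) = 3%N /\ cap i != c.
Proof.
have : cap i \in caps by apply: mem_nth; rewrite size_caps.
by rewrite mem_sort mem_enum inE => /andP[/eqP].
Qed.

Let cap_inj : injective cap.
Proof.
move=> i j /eqP; rewrite nth_uniq ?size_caps // ?sort_uniq ?enum_uniq // => /eqP.
exact: val_inj.
Qed.

Let P := d (nth c caps 0).
Let Q := d (nth c caps 1).
Let R := d (nth c caps 2).
Local Notation l := (arm_length P Q R).

Let lE i : l i = d (cap i).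
Proof. by case: i => [[|[|[|]]]]. Qed.

Let l_gt0 i : (0 < l i)%N.
Proof. by rewrite lE (Gr.1 _ (capP i).2). Qed.

Let sorted_caps : (P <= Q <= R)%N.
Proof.
have : sorted (relpre d leq) caps by apply: sort_sorted => x y; apply: leq_total.
move=> /(sortedP c) s; apply/andP.
by split; [apply: (s 0%N) | apply: (s 1%N)]; rewrite size_caps.
Qed.

(** An arm vertex goes to the ancestor of its cap at the same depth. The boolean of a pendant vertex
    is read as the index 0 or 1 in the list of the two children of the cap. *)
Definition star_map (v : T4 P Q R) : G :=
  match v with
  | None => c
  | Some (inl x) => iter (l (tag x) - (tagged x).+1) par (cap (tag x))
  | Some (inr (i, b)) => nth c (enum (children c par (cap i))) b
  end.

Let star_map_arm i k : (k < l i)%N ->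
  star_map (arm_vertex P Q R i k) = iter (l i - k.+1) par (cap i).
Proof. by move=> h; rewrite /arm_vertex insubT. Qed.

Let size_pendants i : size (enum (children c par (cap i))) = 2%N.
Proof.
have [di ci] := capP i; rewrite -cardE.
by have := degree_children Gr (cap i); rewrite di ci; case: #|_| => [|[|[]]].
Qed.

Let pendantP i (b : bool) (u := nth c (enum (children c par (cap i))) b) :
  [/\ u != c, par u = cap i & degree u = 1%N].
Proof.
have [di ci] := capP i.
have : u \in children c par (cap i) by rewrite -mem_enum mem_nth // size_pendants; case: (b).
move=> uP; have : u \notin nonleaf_children c par (cap i) by rewrite nonleaf_child_branch ?inE.
by rewrite inE uP negbK => /eqP du; move: uP; rewrite inE => /andP[uc /eqP ->].
Qed.

Let star_parent v : v != None ->
  star_map v != c /\ par (star_map v) = star_map (T4_parent v).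
Proof.
case: v => [[x|[i b]]|] // _ /=; last first.
  have [uc -> _] := pendantP i b; split=> //; rewrite star_map_arm ?prednK ?l_gt0 //.
  by rewrite subnn.
have xl := ltn_ord (tagged x); split.
  by apply: (iter_parent_neq Gr) => //; rewrite -lE ltn_subrL l_gt0.
rewrite -iterS; case E: (nat_of_ord (tagged x)) => [|k].
  rewrite subn1 prednK // lE; exact: (iter_parent_root Gr).
by rewrite star_map_arm ?subnSK -?E // ltnW // -E.
Qed.

Let star_degree v : degree (star_map v) = degree v.
Proof.
rewrite (T4_degree (l_gt0 ord0) (l_gt0 1) (l_gt0 2)); case: v => [[x|[i b]]|] /=.
- have xl := ltn_ord (tagged x); have [di ci] := capP (tag x).
  case: eqP => [->|/eqP ne]; first by rewrite subnn.
  have h : ((tagged x).+1 < l (tag x))%N by rewrite ltn_neqAle ne.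
  have m_gt0 : (0 < l (tag x) - (tagged x).+1)%N by rewrite subn_gt0.
  have : (l (tag x) - (tagged x).+1 < d (cap (tag x)))%N by rewrite -lE ltn_subrL l_gt0.
  case: (_ - _)%N m_gt0 => // m _ ml; set u := iter _ _ _.
  have uc : u != c by apply: (iter_parent_neq Gr).
  have u1 : degree u != 1%N by apply: (iter_parent_nonleaf Gr); rewrite ?di // ltnW.
  (* A proper ancestor of a cap cannot have degree 3: it would be a cap itself, yet have a non-leaf
     child. *)
  have /andP[u0 u3] := Gs u; have [E|] := eqVneq (degree u) 3%N; last by lia.
  have : iter m par (cap (tag x)) \in nonleaf_children c par u.
    apply: mem_nonleaf_children; first by apply: (iter_parent_neq Gr) => //; apply: ltnW.
    by apply: (iter_parent_nonleaf Gr); rewrite ?di //; do 2!apply: ltnW.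
  by rewrite nonleaf_child_branch // inE.
- by have [_ _] := pendantP i b.
by [].
Qed.

(** Descending from the common child of [c], uniqueness of the non-leaf child keeps the two arms
    together down to the nearer cap. A longer arm would continue through a non-leaf child of that
    cap, which has none. *)
Let arm_root_inj i j :
  iter (l i).-1 par (cap i) = iter (l j).-1 par (cap j) -> i = j.
Proof.
wlog lij : i j / (l i <= l j)%N.
  by move=> W E; have [/W|/ltnW/W W'] := leqP (l i) (l j); [exact | apply/esym/W'].
move=> E; have [[di ci] [dj cj]] := (capP i, capP j).
have down m : (m <= (l i).-1)%N ->
    iter ((l i).-1 - m) par (cap i) = iter ((l j).-1 - m) par (cap j).
  elim: m => [|m IH] mi; first by rewrite !subn0.
  have Ei := subnSK mi; have Ej : ((l j).-1 - m.+1).+1 = ((l j).-1 - m)%N by lia.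
  have li := l_gt0 i; have ljg := l_gt0 j; have lEi := lE i; have lEj := lE j.
  have {}IH := IH (ltnW mi); rewrite -Ei -Ej !iterS in IH.
  have pc : par (iter ((l i).-1 - m.+1) par (cap i)) != c.
    by rewrite -iterS; apply: (iter_parent_neq Gr) => //; lia.
  apply: (nonleaf_child_le1 pc); last rewrite IH; apply: mem_nonleaf_children.
  - by apply: (iter_parent_neq Gr) => //; lia.
  - by apply: (iter_parent_nonleaf Gr); rewrite ?di //; lia.
  - by apply: (iter_parent_neq Gr) => //; lia.
  - by apply: (iter_parent_nonleaf Gr); rewrite ?dj //; lia.
have := down _ (leqnn _); rewrite subnn /=.
have li := l_gt0 i; have ljg := l_gt0 j; have lEi := lE i; have lEj := lE j.
case E' : ((l j).-1 - (l i).-1)%N => [|m]; first by move=> /cap_inj.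
move=> Ecap; have : iter m par (cap j) \in nonleaf_children c par (cap i).
  rewrite Ecap iterS; apply: mem_nonleaf_children.
    by apply: (iter_parent_neq Gr) => //; lia.
  by apply: (iter_parent_nonleaf Gr); rewrite ?dj //; lia.
by rewrite nonleaf_child_branch // inE.
Qed.

(** Degrees separate pendants from the rest. A pendant is recovered from its parent and index, an
    arm vertex from its depth and its ancestor adjacent to [c]. *)
Let star_map_inj : injective star_map.
Proof.
move=> v v' E.
have [Ev|vN] := eqVneq v None.
  have [->//|v'N] := eqVneq v' None.
  by have [] := star_parent v'N; rewrite -E Ev eqxx.
have [Ev'|v'N] := eqVneq v' None.
  by have [] := star_parent vN; rewrite E Ev' eqxx.
have := star_degree v; rewrite E star_degree !(T4_degree (l_gt0 ord0) (l_gt0 1) (l_gt0 2)).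
case: v v' vN v'N E => [[x|[i b]]|] [[x'|[i' b']]|] //= _ _; last first.
  move=> E _; have [_ pi _] := pendantP i b; have [_ pi' _] := pendantP i' b'.
  have Ei : i = i' by apply: cap_inj; rewrite -pi -pi' E.
  move: E; rewrite -Ei => /eqP; rewrite nth_uniq ?enum_uniq //.
  - by move=> /eqP; case: (b); case: (b').
  - by rewrite size_pendants; case: (b).
  by rewrite size_pendants; case: (b').
move=> E _; have xl := ltn_ord (tagged x); have xl' := ltn_ord (tagged x').
have depth i k : (k < l i)%N -> d (iter (l i - k.+1) par (cap i)) = k.+1.
  by move=> kl; rewrite (iter_parent_depth Gr) -?lE ?leq_subr ?subKn.
have Ek : tagged x = tagged x' :> nat by apply: succn_inj; rewrite -(depth _ _ xl) -(depth _ _ xl') E.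
have up i k : (k < l i)%N -> iter k par (iter (l i - k.+1) par (cap i)) =
    iter (l i).-1 par (cap i).
  by move=> kl; rewrite -iterD; congr iter; lia.
have Et : tag x = tag x'.
  by apply: arm_root_inj; rewrite -(up _ _ xl) E Ek (up _ _ xl').
by rewrite !arm_vertexE Ek Et.
Qed.

Lemma star_isomorphic : exists P Q R : nat,
  [/\ (0 < P)%N, (P <= Q)%N, (Q <= R)%N & isomorphic (T4 P Q R) G].
Proof.
exists P, Q, R; have /andP[PQ QR] := sorted_caps; split=> //; first exact: (l_gt0 ord0).
have TR := T4_rooted (l_gt0 ord0) (l_gt0 1) (l_gt0 2).
apply: (covering_isomorphic (phi := star_map) (x0 := None)).
- exact: rooted_connected Gr.
- move=> x y; rewrite TR.2 => /orP[]/andP[yN /eqP ->].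
    by have [nc <-] := star_parent yN; rewrite edge_sym; apply: (rooted_edge Gr).
  by have [nc <-] := star_parent yN; apply: (rooted_edge Gr).
- exact: star_degree.
- by move=> x y y' _ _ /star_map_inj.
by move=> x /star_map_inj.
Qed.
End Star.

Lemma big_partition4 (R : Type) (idx : R) (op : Monoid.com_law idx) (T : finType)
    (z : T) (A B : {set T}) (F : T -> R) :
    z \notin A -> z \notin B -> [disjoint A & B] ->
  \big[op/idx]_v F v = op (F z) (op (\big[op/idx]_(v in A) F v)
    (op (\big[op/idx]_(v in B) F v) (\big[op/idx]_(v in ~: (z |: (A :|: B))) F v))).
Proof.
move=> zA zB /pred0P AB; rewrite (bigD1 z) //= (bigID (mem A)) /=; congr (op _ (op _ _)).
  apply: eq_bigl => v; case: (boolP (v \in A)) => vA; rewrite ?andbF ?andbT //.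
  by apply: contraNneq zA => <-.
rewrite (bigID (mem B)) /=; congr (op _ _); apply: eq_bigl => v.
  case: (boolP (v \in B)) => vB; rewrite ?andbF ?andbT //.
  have := AB v; rewrite /= vB andbT => ->; rewrite andbT.
  by apply: contraNneq zB => <-.
by rewrite !inE !negb_or andbA.
Qed.

(** * Second shape: the determinant when two branch vertices carry one leaf each *)

Section Caterpillar.
Variables (G : sgraph) (z y : G) (d : G -> nat) (par : G -> G).
Hypotheses (Gr : rooted z d par) (dz : d z = 0%N) (Gs : subcubic G).
Hypotheses (yz : y != z) (z3 : degree z = 3%N) (y3 : degree y = 3%N).
Hypotheses (lz : leaf_degree z = 1%N) (ly : leaf_degree y = 1%N).
Hypothesis l3 : forall v : G, degree v = 3%N -> v != y -> v != z -> leaf_degree v = 2%N.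
Hypothesis l2 : forall v : G, degree v = 2%N -> leaf_degree v = 0%N.
Hypothesis G6 : #|leaves G| = 6%N.

Variables (F : fieldType) (x al t : F) (e : nat -> F).
Hypotheses (al0 : al != 0) (t0 : t != 0) (e_neq0 : forall k, e k != 0).
Hypotheses (alE : al = x - 1) (tE : t = x - 3%:R - 2%:R / al) (tE' : t = x - 2%:R - t^-1).
Hypotheses (e0 : e 0%N = x - 3%:R - al^-1 - t^-1).
Hypothesis eS : forall k, e k.+1 = x - 2%:R - (e k)^-1.

Let z_nonleaf : degree z != 1%N. Proof. by rewrite z3. Qed.
Let cardNC := card_nonleaf_children Gr z_nonleaf.
Local Notation nlc := (nonleaf_children z par).
Local Notation b := (d y).

Let b_gt0 : (0 < b)%N. Proof. by rewrite (Gr.1 _ yz). Qed.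

(** The spine: the path from [y] towards the root [z], with [z] excluded. *)
Let S := [set iter (k : 'I_b) par y | k : 'I_b].

Let SP v : reflect (exists2 k, (k < b)%N & v = iter k par y) (v \in S).
Proof.
apply: (iffP imsetP) => [[k _ ->]|[k kb ->]]; first by exists k.
by exists (Ordinal kb).
Qed.

Let S_depth k : (k < b)%N -> d (iter k par y) = (b - k)%N.
Proof. by move=> kb; apply: (iter_parent_depth Gr) => //; apply: ltnW. Qed.

Let S_nonleaf v : v \in S -> degree v != 1%N.
Proof.
by move=> /SP[k kb ->]; apply: (iter_parent_nonleaf Gr); rewrite ?y3 // ltnW.
Qed.

Let zS : z \notin S.
Proof. by apply/negP => /SP[k kb E]; have := S_depth kb; rewrite -E dz; lia. Qed.

(** Off the spine all non-leaves have pivot [t]: by [tE] at a vertex with two leaves, and by the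
    fixed-point equation [tE'] at degree 2. On the spine the index of [e] is the distance to [y]. *)
Let pivot v : F :=
  if v == z then e 0%N - (e b.-1)^-1 else
  if v \in S then e (b - d v)%N else if degree v == 1%N then al else t.

Let pivot_S k : (k < b)%N -> pivot (iter k par y) = e k.
Proof.
move=> kb; have vS : iter k par y \in S by apply/SP; exists k.
rewrite /pivot vS (negbTE (iter_parent_neq Gr kb dz)) S_depth // subKn //.
exact: ltnW.
Qed.

Let pivot_t v u : u \in nlc v -> u \notin S -> pivot u = t.
Proof.
by rewrite !inE -andbA => /and3P[uz _ u1] /negbTE uS; rewrite /pivot uS (negbTE uz) (negbTE u1).
Qed.

Let children_sum v : \sum_(u | (u != z) && (v == par u)) (pivot u)^-1 =
  \sum_(u in nlc v) (pivot u)^-1 + (leaf_degree v)%:R / al.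
Proof.
rewrite (eq_bigl (fun u => u \in children z par v)) => [|u]; last by rewrite inE.
rewrite (bigID (fun u => degree u != 1%N)) /=; congr (_ + _).
  by apply: eq_bigl => u; rewrite [in RHS]inE.
rewrite (eq_bigr (fun=> al^-1)) => [|u /andP[]]; last first.
  rewrite inE => /andP[uz _] /negPn/eqP u1; rewrite /pivot (negbTE uz) u1 eqxx.
  by case: ifP => // /S_nonleaf; rewrite u1.
rewrite sumr_const mulr_natl; congr (_ *+ _).
have := cardNC v; have := degree_children Gr v => -> /addnI.
rewrite -(cardsID [set u | degree u == 1%N] (children z par v)) addnC.
have -> : #|children z par v :\: [set u | degree u == 1%N]| = #|nlc v|.
  by apply: eq_card => u; rewrite !inE andbC.
by move=> /addnI <-; apply: eq_card => u; rewrite !inE unfold_in /= ?inE ?negbK.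
Qed.

Let sum_off v : (forall u, u \in nlc v -> u \notin S) ->
  \sum_(u in nlc v) (pivot u)^-1 = #|nlc v|%:R / t.
Proof.
move=> off; rewrite (eq_bigr (fun=> t^-1)) => [|u uv]; last by rewrite (pivot_t uv) // off.
by rewrite sumr_const mulr_natl.
Qed.

Let pivotE v :
  pivot v = x - (degree v)%:R - \sum_(u | (u != z) && (v == par u)) (pivot u)^-1.
Proof.
rewrite children_sum; have cv := cardNC v.
have [E|vz] := eqVneq v z.
  (* The root has three children: a leaf, the top [u0] of the spine, and one non-leaf off the
     spine. *)
  pose u0 := iter b.-1 par y.
  have kb : (b.-1 < b)%N by rewrite prednK.
  have u0z : u0 \in nlc z.
    have {2}<- : par u0 = z by rewrite -iterS prednK // (iter_parent_root Gr).
    apply: mem_nonleaf_children; first exact: (iter_parent_neq Gr).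
    by apply: S_nonleaf; apply/SP; exists b.-1.
  rewrite E in cv *; rewrite z3 lz eqxx in cv *.
  have c1 : #|nlc z :\ u0| = 1%N by have := cardsD1 u0 (nlc z); rewrite u0z; lia.
  rewrite (big_setD1 u0) //= pivot_S // (eq_bigr (fun=> t^-1)) => [|u]; last first.
    rewrite in_setD1 => /andP[uu0 uz]; rewrite (pivot_t uz) //.
    apply: contra uu0 => /SP[k kb' Eu]; rewrite Eu; apply/eqP; congr iter.
    have := S_depth kb'; rewrite -Eu; move: uz; rewrite !inE => /andP[/andP[uz /eqP zp] _].
    by rewrite (Gr.1 _ uz) -zp dz; lia.
  by rewrite sumr_const c1 /pivot eqxx e0; ring.
rewrite vz in cv.
have [/SP[k kb Ev]|vS] := boolP (v \in S).
  have pv : pivot v = e k by rewrite Ev pivot_S.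
  case: k kb Ev pv => [|k] kb /= Ev ->.
    (* At the start [y] of the spine the children are a leaf and one non-leaf off the spine, which
       is what [e0] encodes. *)
    rewrite Ev y3 ly in cv *; rewrite sum_off; last first.
      move=> u; rewrite !inE => /andP[/andP[uz /eqP yp] _].
      apply/negP => /SP[k kb' Eu]; have := S_depth kb'; rewrite -Eu (Gr.1 _ uz) -yp; lia.
    have -> : #|nlc y| = 1%N by lia.
    by rewrite e0; ring.
  have uv : iter k par y \in nlc v.
    rewrite Ev; apply: mem_nonleaf_children.
      by apply: (iter_parent_neq Gr) => //; apply: ltnW.
    by apply: S_nonleaf; apply/SP; exists k => //; apply: ltnW.
  have n_gt0 : (0 < #|nlc v|)%N by apply/card_gt0P; exists (iter k par y).
  have vy : v != y.
    by apply/eqP => E; have := S_depth kb; rewrite /= -Ev E; lia.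
  (* With degree 3, two leaves, a parent and the child on the spine would be one neighbour too
     many. *)
  have dv : degree v = 2%N.
    have := Gs v; have := l3 (v := v); move: cv; case: (degree v) => [|[|[|[|]]]] //; first lia.
    by move=> cv l _; have := l erefl vy vz; lia.
  have c1 : #|nlc v| = 1%N by rewrite dv l2 // in cv; lia.
  have /eqP/cards1P[w W] := c1; rewrite W in uv *; move: uv; rewrite inE => /eqP <-.
  by rewrite big_set1 pivot_S ?(ltnW kb) // dv l2 // eS; ring.
(* Below a non-root vertex off the spine there is no spine vertex, as the spine is closed under
   parents up to the root. *)
rewrite sum_off => [|u]; last first.
  rewrite !inE => /andP[/andP[uz /eqP vp] _]; apply: contra vS => /SP[k kb Eu].
  apply/SP; exists k.+1; last by rewrite vp Eu.
  rewrite ltn_neqAle kb andbT; apply: contraNneq vz => Eb.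
  by rewrite vp Eu -iterS Eb (iter_parent_root Gr y dz).
rewrite /pivot (negbTE vz) (negbTE vS).
have vy : v != y by apply: contraNneq vS => ->; apply/SP; exists 0%N.
have := Gs v; case E: (degree v) => [|[|[|[|]]]] //= _; rewrite E in cv.
- have [-> ->] : #|nlc v| = 0%N /\ leaf_degree v = 0%N by lia.
  by rewrite alE; ring.
- rewrite l2 // in cv *; have -> : #|nlc v| = 1%N by lia.
  by rewrite [LHS]tE'; ring.
- rewrite l3 // in cv *; have -> : #|nlc v| = 0%N by lia.
  by rewrite [LHS]tE; ring.
Qed.

Let S_leaves : [disjoint S & leaves G].
Proof.
apply/pred0P => v /=; apply/negbTE; rewrite negb_and.
by case: (boolP (v \in S)) => //= /S_nonleaf; rewrite inE.
Qed.

(** Here [m] counts the non-leaves off the spine other than [z]; the 7 stands for [z] and the six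
    leaves. *)
Lemma caterpillar_det : exists m, (m + b + 7)%N = #|G| /\
  \det (x%:M - laplacian F G) =
    (e 0%N - (e b.-1)^-1) * ((\prod_(k < b) e k) * (al ^+ 6 * t ^+ m)).
Proof.
have zL : z \notin leaves G by rewrite inE.
have S_inj : {in 'I_b &, injective (fun k : 'I_b => iter k par y)}.
  move=> i j _ _ E; apply: val_inj => /=; have := S_depth (ltn_ord i).
  by rewrite E S_depth //; have := ltn_ord i; have := ltn_ord j; lia.
exists #|~: (z |: (S :|: leaves G))|; split.
  have := big_partition4 addn (fun=> 1%N) zS zL S_leaves.
  rewrite sum1_card /= !sum1_card G6 card_in_imset // card_ord => ->; lia.
rewrite (rooted_pivot (f := pivot) Gr) => [|v vz|//]; last first.
  by rewrite /pivot (negbTE vz); case: ifP => // _; case: ifP.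
rewrite (big_partition4 _ _ zS zL S_leaves) /=; congr (_ * (_ * (_ * _))).
- by rewrite /pivot eqxx.
- by rewrite big_imset //=; apply: eq_bigr => k _; rewrite pivot_S.
- rewrite (eq_bigr (fun=> al)) ?prodr_const ?G6 // => v vL.
  have := S_leaves => /pred0P/(_ v) /=; rewrite vL andbT /pivot => ->.
  by move: vL; rewrite inE => /eqP v1; rewrite v1 eqxx; case: eqP => // E; move: z3; rewrite -E v1.
rewrite (eq_bigr (fun=> t)) ?prodr_const // => v; rewrite !inE !negb_or /pivot.
by move=> /and3P[/negbTE -> /negbTE -> /negbTE ->].
Qed.
End Caterpillar.

Lemma sum_arms (R : nmodType) (p q r : nat) (h : nat -> R) :
  \sum_i h (arm_length p q r i) = h p + h q + h r.
Proof. by rewrite !big_ord_recl big_ord0 addr0 addrA. Qed.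

Lemma prod_arms (R : pzSemiRingType) (p q r : nat) (h : nat -> R) :
  \prod_i h (arm_length p q r i) = h p * h q * h r.
Proof. by rewrite !big_ord_recl big_ord0 mulr1 mulrA. Qed.

(** * Recovering the arm lengths from the determinant *)

Section Waves.
Variables (F : fieldType) (t : F).
Hypotheses (t0 : t != 0) (t1 : 1 + t != 0) (tQ : 1 + t + t ^+ 2 != 0).
Let A := 1 - t - t ^+ 2.
Let B := 1 + t - t ^+ 2.
Hypotheses (A0 : A != 0) (B0 : B != 0) (wave_neq0 : forall k, A + t * B * (t ^+ k) ^+ 2 != 0).

(** At x = t + 1/t + 2 the arm pivots are C(k+1)/C(k), where C(k+2) = (t + 1/t) C(k+1) - C(k); the
    coefficients are fitted, up to scale, to the pivot at the outer end of an arm. *)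
Let C k := A * t^-1 ^+ k + t * B * t ^+ k.

Let CE k : t ^+ k * C k = A + t * B * (t ^+ k) ^+ 2.
Proof.
rewrite /C mulrDr [t ^+ k * (A * _)]mulrCA -exprMn divff // expr1n mulr1; congr (_ + _).
by rewrite mulrCA expr2.
Qed.

Let C0 k : C k != 0.
Proof. by apply: contraNneq (wave_neq0 k) => E; rewrite -CE E mulr0. Qed.

Let CS k : t ^+ k.+1 * C k = t * A + B * (t ^+ k.+1) ^+ 2.
Proof. by rewrite exprS -mulrA CE; ring. Qed.

(** [U X] is t^p C(p) and [V X] is t^p C(p-1), so V/U is the inverse of the pivot next to the
    center. The pivots of an arm telescope to C(p)/C(0), which explains the factor clearing
    denominators. *)
Lemma T4_det_waves (p q r : nat) (X := t ^+ p ^+ 2) (Y := t ^+ q ^+ 2) (Z := t ^+ r ^+ 2)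
    (U := fun X => A + t * B * X) (V := fun X => t * A + B * X) :
    (0 < p)%N -> (0 < q)%N -> (0 < r)%N ->
  \det ((t + t^-1 + 2%:R)%:M - laplacian F (T4 p q r)) * (C 0 ^+ 3 * t ^+ (p + q + r)) =
  ((t + t^-1 - 1) * (U X * U Y * U Z) - V X * U Y * U Z - U X * V Y * U Z - U X * U Y * V Z)
    * (t + t^-1 + 1) ^+ 6.
Proof.
case: p q r @X @Y @Z => [|p] [|q] [|r] // X Y Z _ _ _.
have al0 : t + t^-1 + 1 != 0.
  have E : t * (t + t^-1 + 1) = 1 + t + t ^+ 2 by field.
  by move: tQ; rewrite -E mulf_eq0 (negbTE t0).
pose g k := C k.+1 / C k.
have gprod n : \prod_(k < n) g k = C n / C 0.
  elim: n => [|n IH]; first by rewrite big_ord0 divff.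
  by rewrite big_ord_recr /= IH /g mulrC mulrA divfK.
rewrite (T4_det _ _ _ (al := t + t^-1 + 1) (g := g)) //.
- rewrite (sum_arms _ _ _ (fun n => (g n.-1)^-1)) (prod_arms _ _ _ (fun n => \prod_(k < n) g k)) !gprod.
  rewrite /g /= !invf_div.
  have UE k : U (t ^+ k ^+ 2) = t ^+ k * C k by rewrite CE.
  have VE k : V (t ^+ k.+1 ^+ 2) = t ^+ k.+1 * C k by rewrite CS.
  rewrite /X /Y /Z !UE !VE !exprD.
  have := (C0 0, C0 p, C0 q, C0 r, C0 p.+1, C0 q.+1, C0 r.+1).
  move: (C 0) (C p) (C q) (C r) (C p.+1) (C q.+1) (C r.+1) => c0 c1 c2 c3 c4 c5 c6 cn.
  by field; rewrite ?t0 ?cn.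
- by move=> k; rewrite /g mulf_neq0 ?invr_eq0 ?C0.
- by ring.
- have := C0 0; rewrite /g /C !expr0 !expr1 /A /B !mulr1 => c0; field.
  by rewrite t0 c0 (_ : t * t + 1 + t = 1 + t + t ^+ 2) ?tQ //; ring.
move=> k; rewrite /g invf_div.
have -> : C k.+2 = (t + t^-1) * C k.+1 - C k.
  by rewrite /C !exprS; move: (t^-1 ^+ k) (t ^+ k) => u v; field.
by have := C0 k.+1; move: (C k.+1) (C k) => a b a0; field; rewrite a0 t0.
Qed.

(** The right-hand side of [T4_det_waves] is affine in the elementary symmetric functions of X, Y,
    Z. The product XYZ depends only on p + q + r, and the other two coefficients are -t(1+t)AB times
    A and B. *)
Lemma T4_det_compare (p q r p' q' r' : nat) :
    (0 < p)%N -> (0 < q)%N -> (0 < r)%N -> (0 < p')%N -> (0 < q')%N -> (0 < r')%N ->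
    (p + q + r = p' + q' + r')%N ->
    \det ((t + t^-1 + 2%:R)%:M - laplacian F (T4 p q r)) =
    \det ((t + t^-1 + 2%:R)%:M - laplacian F (T4 p' q' r')) ->
  let X := fun k => t ^+ k ^+ 2 in
  A * (X p + X q + X r - (X p' + X q' + X r')) +
  B * (X p * X q + X q * X r + X p * X r - (X p' * X q' + X q' * X r' + X p' * X r')) = 0.
Proof.
move=> p0 q0 r0 p'0 q'0 r'0 N detE X.
have al0 : t + t^-1 + 1 != 0.
  have E : t * (t + t^-1 + 1) = 1 + t + t ^+ 2 by field.
  by move: tQ; rewrite -E mulf_eq0 (negbTE t0).
have al6 : (t + t^-1 + 1) ^+ 6 != 0 by rewrite expf_neq0.
have := T4_det_waves p0 q0 r0; rewrite detE N T4_det_waves // => /(mulIf al6).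
have : X p * X q * X r = X p' * X q' * X r' by rewrite /X -!exprMn -!exprD N.
rewrite -/(X p) -/(X q) -/(X r) -/(X p') -/(X q') -/(X r').
move: (X p) (X q) (X r) (X p') (X q') (X r') => x y z x' y' z' e3 E.
have nz : t * (1 + t) * A * B != 0 by rewrite !mulf_neq0.
apply: (mulfI nz); rewrite mulr0.
move/eqP: E; rewrite -subr_eq0 => /eqP E; move/eqP: e3; rewrite -subr_eq0 => /eqP e3.
have comb (g a b k : F) : a = 0 -> b = 0 -> g = a + k * b -> g = 0.
  by move=> -> -> ->; rewrite mulr0 addr0.
(* The multiplier is the coefficient of the product XYZ. *)
apply: (comb _ _ _ (((t + t^-1 - 1) * t - 3%:R) * t ^+ 2 * B ^+ 3) E e3).
by move: (A) (B) => a b; field.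
Qed.
End Waves.

(** Three powers of 4 with exponents at most [a] sum to less than 4^(a+1). *)
Lemma base4_leading (a b c a' b' c' : nat) : (b <= a)%N -> (c <= a)%N ->
  (4 ^ a + 4 ^ b + 4 ^ c = 4 ^ a' + 4 ^ b' + 4 ^ c')%N -> (a' <= a)%N.
Proof.
move=> ba ca E; rewrite leqNgt; apply/negP => aa'.
have hb : (4 ^ b <= 4 ^ a)%N by rewrite leq_exp2l.
have hc : (4 ^ c <= 4 ^ a)%N by rewrite leq_exp2l.
have : (4 ^ a.+1 <= 4 ^ a')%N by rewrite leq_exp2l.
have := expn_gt0 4 a; rewrite expnS /=; lia.
Qed.

Lemma base4_inj (a b c a' b' c' : nat) :
    (c <= b <= a)%N -> (c' <= b' <= a')%N ->
    (4 ^ a + 4 ^ b + 4 ^ c = 4 ^ a' + 4 ^ b' + 4 ^ c')%N ->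
  [/\ a = a', b = b' & c = c'].
Proof.
move=> /andP[cb ba] /andP[cb' ba'] E.
have Ea : a = a'.
  by apply/eqP; rewrite eqn_leq (base4_leading _ _ E) ?(base4_leading _ _ (esym E)) //;
     apply: leq_trans; eassumption.
subst a'; have {}E : (4 ^ b + 4 ^ c + 4 ^ c = 4 ^ b' + 4 ^ c' + 4 ^ c)%N by lia.
have E2 : (4 ^ b + 4 ^ c = 4 ^ b' + 4 ^ c')%N by lia.
have Eb : b = b'.
  apply/eqP; rewrite eqn_leq; apply/andP; split.
    (* The two-term identity is padded with a common third power. *)
    apply: (base4_leading (b := c') (c := c') (b' := c) (c' := c')) => //; lia.
  apply: (base4_leading (b := c) (c := c) (b' := c') (c' := c)) => //; lia.
subst b'; split=> //; apply/eqP; rewrite -(eqn_exp2l _ _ (isT : 1 < 4)%N); apply/eqP; lia.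
Qed.

(** Replacing t = 1/2 by t = -1/2 keeps the squares t^(2k) and swaps the coefficients A = 1/4 and B
    = 5/4 of [T4_det_compare]. The two equations are independent, so the second symmetric functions
    agree; multiplied by 4^(p+q+r) they become 4^p + 4^q + 4^r. *)
Lemma T4_det_inj (p q r p' q' r' : nat) :
    (0 < p)%N -> (p <= q)%N -> (q <= r)%N -> (0 < p')%N -> (p' <= q')%N -> (q' <= r')%N ->
    (p + q + r = p' + q' + r')%N ->
    (forall x, \det (x%:M - laplacian algC (T4 p q r)) =
               \det (x%:M - laplacian algC (T4 p' q' r'))) ->
  [/\ p = p', q = q' & r = r'].
Proof.
move=> p0 pq qr p'0 pq' qr' N detE.
have q0 := leq_trans p0 pq; have r0 := leq_trans q0 qr.
have q'0 := leq_trans p'0 pq'; have r'0 := leq_trans q'0 qr'.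
pose h : algC := 2%:R^-1.
have two0 : (2%:R : algC) != 0 by rewrite pnatr_eq0.
have h_gt0 : 0 < h by rewrite invr_gt0 ltr0n.
have sq k : (- h) ^+ k ^+ 2 = h ^+ k ^+ 2 by rewrite -!exprM mulnC !exprM sqrrN.
have nn k : 0 <= h ^+ k ^+ 2 by rewrite !exprn_ge0 // ltW.
have le1 k : h ^+ k ^+ 2 <= 1.
  by rewrite !exprn_ile1 // ?exprn_ge0 ?ltW // invf_lt1 ?ltr0n // ltr1n.
have h2 : 0 < h ^+ 2 by rewrite exprn_gt0.
have hE : 1 - h = h by rewrite /h; field.
have E1 : 1 - h - h ^+ 2 = h ^+ 2 by rewrite /h; field.
have E2 : 1 + h - h ^+ 2 = 1 + h ^+ 2 by rewrite /h; field.
have E3 : 1 + - h - (- h) ^+ 2 = h ^+ 2 by rewrite /h; field.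
have E4 : 1 - - h - (- h) ^+ 2 = 1 + h ^+ 2 by rewrite /h; field.
have pos1 : 0 < 1 + h ^+ 2 by rewrite addr_gt0.
have nz (a : algC) : 0 < a -> a != 0 by move=> /lt0r_neq0.
have hn : 0 < 1 - h by rewrite hE.
have w1 k : 1 - h - h ^+ 2 + h * (1 + h - h ^+ 2) * h ^+ k ^+ 2 != 0.
  rewrite E1 E2; apply/nz; apply: ltr_wpDr => //.
  by apply: mulr_ge0 (nn k); apply: mulr_ge0; apply: ltW.
have w2 k : 1 - - h - (- h) ^+ 2 + - h * (1 + - h - (- h) ^+ 2) * (- h) ^+ k ^+ 2 != 0.
  rewrite E4 E3 sq; set X := h ^+ k ^+ 2.
  have -> : 1 + h ^+ 2 + - h * h ^+ 2 * X = 1 + h ^+ 2 * (1 - X + (1 - h) * X) by ring.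
  rewrite nz // ltr_wpDr ?ltr01 // mulr_ge0 ?(ltW h2) // addr_ge0 ?subr_ge0 ?le1 //.
  by rewrite mulr_ge0 ?nn // ltW.
have hN : - h != 0 by rewrite oppr_eq0 nz.
have hN1 : 1 + - h != 0 by rewrite nz.
have hN2 : 1 + - h + (- h) ^+ 2 != 0 by rewrite sqrrN nz // addr_gt0.
have hA : 1 - h - h ^+ 2 != 0 by rewrite E1 nz.
have hB : 1 + h - h ^+ 2 != 0 by rewrite E2 nz.
have hA' : 1 - - h - (- h) ^+ 2 != 0 by rewrite E4 nz.
have hB' : 1 + - h - (- h) ^+ 2 != 0 by rewrite E3 nz.
have D1 := T4_det_compare (nz _ h_gt0) (nz _ (addr_gt0 ltr01 h_gt0))
  (nz _ (addr_gt0 (addr_gt0 ltr01 h_gt0) h2)) hA hB w1 p0 q0 r0 p'0 q'0 r'0 N (detE _).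
have D2 := T4_det_compare hN hN1 hN2 hA' hB' w2 p0 q0 r0 p'0 q'0 r'0 N (detE _).
rewrite /= E1 E2 in D1; rewrite /= E3 E4 !sq in D2.
pose X k := h ^+ k ^+ 2; have X4 k : X k * 4%:R ^+ k = 1.
  by rewrite /X -exprM mulnC exprM -exprMn /h (_ : 2^-1 ^+ 2 * 4%:R = 1 :> algC) ?expr1n //; field.
rewrite -!/(X _) in D1 D2.
have {D1 D2} S2 : X p * X q + X q * X r + X p * X r = X p' * X q' + X q' * X r' + X p' * X r'.
  have k0 : 1 + h ^+ 2 *+ 2 != 0 by rewrite nz // addr_gt0 // mulrn_wgt0.
  apply/eqP; rewrite -subr_eq0; apply/eqP; apply: (mulfI k0); rewrite mulr0.
  move: D1 D2; set s1 := (X p + _ + _ - _); set s2 := (_ - _) => D1 D2.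
  have -> : (1 + h ^+ 2 *+ 2) * s2 =
      (1 + h ^+ 2) * (h ^+ 2 * s1 + (1 + h ^+ 2) * s2) -
      h ^+ 2 * ((1 + h ^+ 2) * s1 + h ^+ 2 * s2) by ring.
  by rewrite D1 D2 !mulr0 subr0.
have S4 (a b c : nat) : (X a * X b + X b * X c + X a * X c) * 4%:R ^+ (a + b + c) =
    (4 ^ c + 4 ^ b + 4 ^ a)%:R.
  rewrite !natrD !natrX !exprD; move: (X4 a) (X4 b) (X4 c).
  move: (X a) (X b) (X c) (4%:R ^+ a) (4%:R ^+ b) (4%:R ^+ c) => x y z u v w xu yv zw.
  transitivity (x * u * (y * v) * w + y * v * (z * w) * u + x * u * (z * w) * v); first by ring.
  by rewrite xu yv zw; ring.
have := S4 p q r; rewrite S2 N S4 => /eqP; rewrite eqr_nat => /eqP E.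
by have [||-> -> ->] := base4_inj _ _ E; rewrite ?pq ?qr ?pq' ?qr'.
Qed.

(** * Excluding the second shape at a golden-ratio point *)

Lemma golden_ratio_conj : exists t : algC, [/\ 0 < t, t < 1 & t ^+ 2 = 1 - t].
Proof.
pose s : algC := sqrtC 5%:R; have s2 : s ^+ 2 = 5%:R by rewrite sqrtCK.
have s0 : 0 <= s by rewrite sqrtC_ge0 ler0n.
have s_gt1 : 1 < s by rewrite -(ltr_pXn2r (n := 2)) ?nnegrE ?ler01 // s2 expr1n ltr1n.
have s_lt3 : s < 3%:R.
  by rewrite -(ltr_pXn2r (n := 2)) ?nnegrE ?ler0n // s2 -natrX ltr_nat.
exists ((s - 1) / 2%:R); split.
- by rewrite divr_gt0 ?ltr0n // subr_gt0.
- by rewrite ltr_pdivrMr ?ltr0n // mul1r ltrBlDr -(natrD _ 2 1).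
have -> : ((s - 1) / 2%:R) ^+ 2 = (s ^+ 2 - s *+ 2 + 1) / 4%:R by field.
by rewrite s2; field.
Qed.

Section Golden.
Variable t : algC.
Hypotheses (t_gt0 : 0 < t) (t_lt1 : t < 1) (tt : t ^+ 2 = 1 - t).

Let t_neq0 : t != 0. Proof. exact: lt0r_neq0. Qed.

Let tV : t^-1 = 1 + t.
Proof. by apply: (mulfI t_neq0); rewrite divff // mulrDr mulr1 -expr2 tt; ring. Qed.

Let half : algC := 2%:R^-1.
Let half_gt0 : 0 < half. Proof. by rewrite invr_gt0 ltr0n. Qed.

(** Closed form of the product of the first [k] spine pivots: the solution of [ES] with E(0) = 1 and
    E(1) = t/2 - 1. *)
Let E k : algC := (2%:R + half * t) * t ^+ k - (1 + half * t) * t^-1 ^+ k.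

Let ht : 0 < half * t. Proof. exact: mulr_gt0. Qed.
Let tk_le1 k : t ^+ k <= 1. Proof. by rewrite exprn_ile1 // ltW. Qed.
Let tVk_ge1 k : 1 <= t^-1 ^+ k.
Proof. by rewrite exprn_ege1 // invf_ge1 // ltW. Qed.

Let ES k : E k.+2 = (t + t^-1) * E k.+1 - E k.
Proof. by rewrite /E !exprS; move: (t ^+ k) (t^-1 ^+ k) => u v; field. Qed.

(** [E 0] is 1, and all later values are negative. *)
Let E_neq0 k : E k != 0.
Proof.
case: k => [|k]; first by rewrite /E !expr0 (_ : _ - _ = 1) ?oner_eq0 //; ring.
rewrite -oppr_eq0; apply: lt0r_neq0.
have -> : - E k.+1 = (1 + half * t) * (1 + t) * (t^-1 ^+ k - 1) +
    (2%:R + half * t) * t * (1 - t ^+ k) + (half + half * (1 - t)).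
  by rewrite /E !exprS {1}tV /half; move: (t ^+ k) (t^-1 ^+ k) => u v; field: tt.
have h1 : 0 < 1 + half * t by rewrite addr_gt0.
have h2 : 0 < 2%:R + half * t by rewrite addr_gt0 ?ltr0n.
apply: ltr_wpDl.
  apply: addr_ge0; apply: mulr_ge0; rewrite ?subr_ge0 //; apply: mulr_ge0; apply: ltW => //.
  by rewrite addr_gt0.
by rewrite addr_gt0 // mulr_gt0 // subr_gt0.
Qed.

Let e k := E k.+1 / E k.

(** In T_4 all non-root pivots are [t] or [al]; in [G] only the spine and the root differ. After the
    common factors cancel, an equation in the depth of [y] alone remains. *)
Lemma golden_caterpillar (G : sgraph) (z y : G) (d : G -> nat) (par : G -> G) (p q r : nat) :
    rooted z d par -> d z = 0%N -> subcubic G -> y != z ->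
    degree z = 3%N -> degree y = 3%N -> leaf_degree z = 1%N -> leaf_degree y = 1%N ->
    (forall v : G, degree v = 3%N -> v != y -> v != z -> leaf_degree v = 2%N) ->
    (forall v : G, degree v = 2%N -> leaf_degree v = 0%N) ->
    #|leaves G| = 6%N ->
    (0 < p)%N -> (0 < q)%N -> (0 < r)%N -> #|G| = #|T4 p q r| ->
    (forall x, \det (x%:M - laplacian algC G) = \det (x%:M - laplacian algC (T4 p q r))) ->
  False.
Proof.
move=> Gr dz Gs yz z3 y3 lz ly l3 l2 G6 p0 q0 r0 cardE detE.
(* Since t(1 + t) = 1, this gives 2/al = t, so [t] is both the pivot above two leaves and a fixed
   point of f -> x - 2 - 1/f. *)
pose al := 2%:R + 2%:R * t; pose x := 3%:R + 2%:R * t.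
have alV : al^-1 = half * t.
  have al0 : al != 0 by rewrite lt0r_neq0 // addr_gt0 ?ltr0n // mulr_gt0 ?ltr0n.
  apply: (mulfI al0); rewrite divff // /al /half.
  by field: tt.
have al0 : al != 0 by rewrite -invr_eq0 alV lt0r_neq0.
have alE : al = x - 1 by rewrite /al /x; ring.
have tE : t = x - 3%:R - 2%:R / al by rewrite alV /x /half; field.
have tE' : t = x - 2%:R - t^-1 by rewrite tV /x; ring.
have e_neq0 k : e k != 0 by rewrite mulf_neq0 ?invr_eq0.
have e0 : e 0%N = x - 3%:R - al^-1 - t^-1.
  rewrite /e (_ : E 0 = 1); last by rewrite /E !expr0; ring.
  by rewrite divr1 /E !expr1 alV tV /x /half; field: tt.
have eS k : e k.+1 = x - 2%:R - (e k)^-1.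
  rewrite /e invf_div ES tV (_ : t + (1 + t) = x - 2%:R); last by rewrite /x; ring.
  by rewrite mulrBl mulfK.
have eprod n : \prod_(k < n) e k = E n.
  elim: n => [|n IH]; first by rewrite big_ord0 /E !expr0; ring.
  by rewrite big_ord_recr /= IH /e mulrC divfK.
have [m [mn]] := caterpillar_det Gr dz Gs yz z3 y3 lz ly l3 l2 G6 al0 (ltac:(exact: t_neq0)) e_neq0 alE tE tE' e0 eS.
rewrite detE (T4_det p0 q0 r0 al0 (fun=> t_neq0) alE tE (fun=> tE')).
rewrite [X in _ = _ * (X * _)]eprod.
under eq_bigr => i _ do rewrite prodr_const card_ord.
rewrite [X in _ - X](sum_arms p q r (fun=> t^-1)).
rewrite [X in _ * (X * _) = _](prod_arms p q r (fun n => t ^+ n)) -!exprD.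
have b_gt0 : (0 < d y)%N by rewrite (Gr.1 _ yz).
(* Both graphs have the same number of vertices, p + q + r + 7 = m + d(y) + 7. *)
have -> : (p + q + r = m + d y)%N by move: mn; rewrite cardE card_T4 //; lia.
case: (d y) b_gt0 => // b _ /=.
have e00 : e 0%N = half * t - 1 by rewrite e0 alV tV /x /half; field.
rewrite e00 /e invf_div => D; have {}D : (x - 3%:R - (t^-1 + t^-1 + t^-1)) * t ^+ b.+1 =
    (half * t - 1) * E b.+1 - E b.
  have k0 : t ^+ m * al ^+ 6 != 0 by rewrite mulf_neq0 // expf_neq0.
  apply: (mulIf k0); have {D} := D; rewrite exprD; have := E_neq0 b.+1.
  move: (E b.+1) (E b) (al ^+ 6) (t ^+ m) (t ^+ b.+1) => u v a w y' u0 D.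
  transitivity ((x - 3%:R - (t^-1 + t^-1 + t^-1)) * (w * y' * a)); first by ring.
  by rewrite D; field.
(* Impossible by size: 2 + 5t/4 exceeds 3/4 + t/2, while t^-b >= 1 >= t^b. *)
have : (2%:R + half ^+ 2 * 5%:R * t) * t^-1 ^+ b = (half ^+ 2 * 3%:R + half * t) * t ^+ b.
  move: D; rewrite /E !exprS; move: (t ^+ b) (t^-1 ^+ b) => u v /eqP.
  rewrite tV -subr_eq0 => D; apply/eqP; rewrite eq_sym -subr_eq0; move: D.
  by congr (_ == _); rewrite /x /half; field: tt.
move: (tk_le1 b) (tVk_ge1 b) (exprn_gt0 b t_gt0); move: (t ^+ b) (t^-1 ^+ b) => u v u1 v1 u0 D'.
have hh : 0 < half ^+ 2 by rewrite exprn_gt0.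
have : 0 < (2%:R + half ^+ 2 * 5%:R * t) * v - (half ^+ 2 * 3%:R + half * t) * u.
  have -> : (2%:R + half ^+ 2 * 5%:R * t) * v - (half ^+ 2 * 3%:R + half * t) * u =
     (2%:R + half ^+ 2 * 5%:R * t) * (v - 1) + (half ^+ 2 * 3%:R + half * t) * (1 - u)
     + (half ^+ 2 * 5%:R + half ^+ 2 * 3%:R * t) by rewrite /half; field.
  apply: ltr_wpDl.
    apply: addr_ge0; apply: mulr_ge0; rewrite ?subr_ge0 // ltW //.
      by rewrite addr_gt0 ?ltr0n // !mulr_gt0 ?ltr0n.
    by rewrite addr_gt0 // mulr_gt0 ?ltr0n.
  by rewrite addr_gt0 // !mulr_gt0 ?ltr0n.
by rewrite D' subrr ltxx.
Qed.
End Golden.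

Theorem theorem3p9 (p q r : nat) (hp : (1 <= p)%N) (hpq : (p <= q)%N)
    (hqr : (q <= r)%N) :
  determined_by_laplacian_spectrum (T4 p q r).
Proof.
move=> H HT; have q0 := leq_trans hp hpq; have r0 := leq_trans q0 hqr.
have TR := T4_rooted hp q0 r0.
have T1 : (1 < #|T4 p q r|)%N by rewrite card_T4 //; lia.
have Ts := T4_subcubic hp q0 r0.
have Hs := same_subcubic HT TR Ts T1.
have H6 : #|leaves H| = 6%N by rewrite (same_leaves HT TR Ts T1) T4_leaves.
have Hl := same_leaf_neighbors HT TR Ts T1 (T4_leaf_neighbors hp q0 r0).
have Hc := same_connected HT TR; have Hd := same_sum_degree HT TR.
have l2 (v : H) := leaf_degree2 Hl (v := v).
have b4 := card_branches Hs H6 Hd.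
have [[c [c3 lc l3]]|[y [z [yz [y3 z3] [ly lz] l3]]]] := leaf_cases Hc Hs H6 Hd Hl.
  have [d [par [Hr dc]]] := same_rooted HT TR c.
  have [p' [q' [r' [p'0 pq' qr' iso]]]] := star_isomorphic Hr dc Hs c3 lc l3 l2 b4.
  have cardE : #|T4 p' q' r'| = #|T4 p q r|.
    by rewrite -(same_card HT); have [f /bij_eq_card ->] := iso.
  have q'0 := leq_trans p'0 pq'; have r'0 := leq_trans q'0 qr'.
  have [E1 E2 E3] : [/\ p' = p, q' = q & r' = r].
    apply: T4_det_inj => // [|x]; last by rewrite (isomorphic_det x iso) (same_det HT).
    by move: cardE; rewrite !card_T4 //; lia.
  by rewrite E1 E2 E3 in iso; apply: isomorphic_sym.
have [d [par [Hr dz]]] := same_rooted HT TR z.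
have [t [t0 t1 tt]] := golden_ratio_conj.
by case: (golden_caterpillar t0 t1 tt Hr dz Hs yz z3 y3 lz ly l3 l2 H6 hp q0 r0
  (same_card HT) (same_det HT)).
Qed.
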